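(* Assume that under $P$ the environment $\omega=\{\omega_x\}_{x\in\mathbb{Z}}$ is an i.i.d. sequence and that $E_P[\log\rho_0]\in(-\infty,0)$. Then: (1) $E_\omega[\mathfrak{R}\mid \mathfrak{R}<\infty]<\infty$ for $P$-a.e. environment $\omega$. (2) $\mathbb{E}[\mathfrak{R}\mid \mathfrak{R}<\infty]<\infty$ if and only if $E_P[\rho_0]<1$.
   Context: An environment is a sequence $\omega=\{\omega_x\}_{x\in\mathbb{Z}}\in[0,1]^{\mathbb{Z}}$. Given $\omega$, the random walk $\{X_n\}_{n\ge0}$ started at $0$ in the environment $\omega$ is the Markov chain on $\mathbb{Z}$ with $X_0=0$ which jumps from $x$ to $x+1$ with probability $\omega_x$ and from $x$ to $x-1$ with probability $1-\omega_x$. Its law (the quenched law) is denoted $P_\omega$, with expectation $E_\omega$. The environment is random with distribution $P$ (a probability measure on $[0,1]^{\mathbb{Z}}$), with expectation $E_P$. The averaged law of the walk is $\mathbb{P}(\cdot)=E_P[P_\omega(\cdot)]$, with expectation $\mathbb{E}$. Set $\rho_x=\frac{1-\omega_x}{\omega_x}$ for $x\in\mathbb{Z}$. The return time to the starting point is $\mathfrak{R}=\inf\{n\ge1: X_n=X_0\}$, with $\inf\emptyset=\infty$. Conditional expectations given an event $A$ of positive probability have the elementary meaning, e.g. $\mathbb{E}[\mathfrak{R}\mid A]=\mathbb{E}[\mathfrak{R}\mathbf{1}_A]/\mathbb{P}(A)$. *)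

(* Defs.v *)
From HB Require Import structures.
From mathcomp Require Import all_boot all_order all_algebra.
From mathcomp Require Import all_classical all_reals all_analysis.

Set Implicit Arguments.
Unset Strict Implicit.
Unset Printing Implicit Defensive.

Import Order.TTheory GRing.Theory Num.Theory.
Import numFieldNormedType.Exports.

Local Open Scope classical_set_scope.
Local Open Scope ring_scope.

HB.instance Definition _ (R : realType) := isPointed.Build {i01 R} 0%:i01.
HB.instance Definition _ := isPointed.Build int 0.

Definition env_cylinders (R : realType) : set (set (int -> {i01 R})) :=
  \bigcup_x preimage_set_system setT
    (fun w : int -> {i01 R} => (w x)%:num) (@measurable _ R).

(* [0,1]^Z with the product of the Borel sigma-algebras *)
Definition environment (R : realType) := g_sigma_algebraType (@env_cylinders R).

Definition omega (R : realType) (w : environment R) (x : int) : R := (w x)%:num.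

(* With the conventions of \bar R, rho w x = +oo if omega w x = 0, and
   lne (rho w x) = -oo if omega w x = 1. *)
Definition rho (R : realType) (w : environment R) (x : int) : \bar R :=
  ((1 - omega w x)%:E / (omega w x)%:E)%E.

Definition trajectory_cylinders : set (set (nat -> int)) :=
  \bigcup_n preimage_set_system setT
    (fun X : nat -> int => X n) [set: set int].

(* Z^N with the product of the discrete sigma-algebras *)
Definition trajectory := g_sigma_algebraType trajectory_cylinders.

Definition iid d (T : measurableType d) (R : realType) (P : probability T R)
    (I : choiceType) (xi : I -> T -> R) : Prop :=
  [/\ forall i, measurable_fun setT (xi i),
      forall (s : seq I) (B : I -> set R), uniq s ->
        (forall i, measurable (B i)) ->
        P (\bigcap_(i in [set` s]) (xi i @^-1` B i)) =
        (\prod_(i <- s) P (xi i @^-1` B i))%E &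
      forall (i j : I) (B : set R), measurable B ->
        P (xi i @^-1` B) = P (xi j @^-1` B)].

Definition jump (R : realType) (w : environment R) (x y : int) : R :=
  if y == x + 1 then omega w x
  else if y == x - 1 then 1 - omega w x
  else 0.

(* mu is the law on the space of trajectories of the Markov chain started at
   0 with transition probabilities jump w; the finite-dimensional distributions are
   given recursively, so that mu is determined by w. *)
Definition is_walk_law (R : realType) (w : environment R)
    (mu : set trajectory -> \bar R) : Prop :=
  mu [set X : trajectory | X 0%N = 0] = 1%E /\
  forall (n : nat) (x : nat -> int),
    mu [set X : trajectory | forall i, (i <= n.+1)%N -> X i = x i] =
    (mu [set X : trajectory | forall i, (i <= n)%N -> X i = x i] *
     (jump w (x n) (x n.+1))%:E)%E.

Section averaged_law.
Local Open Scope ereal_scope.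
Context (R : realType) (P : probability (environment R) R)
  (Q : R.-pker (environment R) ~> trajectory).

Definition averaged (A : set trajectory) : \bar R := \int[P]_w Q w A.

Let averaged0 : averaged set0 = 0.
Proof. by rewrite /averaged integral0_eq. Qed.

Let averaged_ge0 A : 0 <= averaged A.
Proof. exact: integral_ge0. Qed.

Let averaged_sigma_additive : semi_sigma_additive averaged.
Proof.
move=> F mF tF mUF.
rewrite [X in _ --> X](_ : _ = \int[P]_w (\sum_(0 <= k <oo) Q w (F k))).
  rewrite [X in X @ _](_ : _ =
    (fun n => \int[P]_w (\sum_(0 <= i < n) Q w (F i)))); last first.
    apply/funext => n; rewrite -ge0_integral_sum// => k.
    exact: measurable_kernel.
  apply: cvg_monotone_convergence => //.
  - by move=> n; apply: emeasurable_sum => m; exact: measurable_kernel.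
  - by move=> n w _; rewrite sume_ge0.
  - by move=> w _ m n mn; exact: ereal_nondecreasing_series.
apply: eq_integral => w _.
by apply/esym/cvg_lim => //; exact: measure_semi_sigma_additive.
Qed.

HB.instance Definition _ := isMeasure.Build _ _ _ averaged
  averaged0 averaged_ge0 averaged_sigma_additive.

Let averaged_setT : averaged setT = 1.
Proof.
rewrite /averaged -[RHS](@probability_setT _ _ _ P) -[RHS]mul1e.
rewrite -integral_cst//; apply: eq_integral => w _.
exact: prob_kernel.
Qed.

HB.instance Definition _ := Measure_isProbability.Build _ _ _
  averaged averaged_setT.

End averaged_law.

(* +oo if X never returns *)
Definition return_time (R : realType) (X : trajectory) : \bar R :=
  ereal_inf [set (n%:R%:E : \bar R) | n in
    [set n : nat | (1 <= n)%N /\ X n = X 0%N]].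

(* E[f | A] = E[f 1_A] / P(A); in \bar R, +oo * 0 = 0 *)
Definition cond_expectation d (T : measurableType d) (R : realType)
    (mu : {measure set T -> \bar R}) (f : T -> \bar R) (A : set T) : \bar R :=
  ((\int[mu]_x (f x * (\1_A x)%:E)) / mu A)%E.

(* Main.v *)
Require Import Defs.
From HB Require Import structures.
From mathcomp Require Import all_boot all_order all_algebra.
From mathcomp Require Import all_classical all_reals all_analysis.
From mathcomp Require Import measurable_realfun ring lra zify.

(** Let rho_x be the odds (1 - omega_x) / omega_x, Pi_n = rho_1 ... rho_n,
    V = sum_n Pi_n and W_n = sum_(k >= n) Pi_k.  A first return to 0 is one
    step to 1 or to -1 followed by a first passage at 0, so the theorem is
    about the time that two birth-death chains on the naturals, absorbed at 0,
    take to hit 0 from 1, restricted to the event that they do.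

    Quenched cost.  For a chain with edge conductances C_k and a positive
    harmonic function H with H 0 = 1, this expected time is at most
    sum_k (C_(k-1) + C_k) (H k)^2 (time_cost_le).  On the left the conductances
    are the Pi_k of the reflected environment and H = 1: the time is at most
    twice the V of the reflected environment, and also at least that V, because
    that chain is recurrent (time_cost_ge).  On the right the conductances are
    the 1 / Pi_k and H k = W_k / W_0 is the probability of coming back: the time
    is at most twice sum_n W_n^2 / (Pi_n W_0^2) (right_cost_le), whose n-th term
    is called visits n below.

    Almost sure finiteness.  Partial sums of i.i.d. integrable variables with
    negative mean are almost surely bounded above (ae_bounded_sums); this is
    derived from the maximal ergodic inequality on the event that they are
    unbounded, which is invariant under translation, hence independent of any
    single summand.  Applied to log rho and to - log rho with suitable constants
    added, it encloses Pi_n between two exponentials (ae_exponential) whose rates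
    are close enough for V and the sum of the visits n to be finite.  This is (1).

    Averaged cost.  By independence E[V] = sum_n E[rho]^n, which is finite exactly
    when E[rho] < 1.  If the averaged cost is finite then so is E[V], because
    the left chain is entered with probability 1 - omega_0, which is independent
    of that chain.  Conversely, by stationarity E[visits n] does not change when
    the environment is translated by - n, and then the sum over n is at most
    1 + V pointwise, by telescoping 1 / W (visits_translate_sum_le); so the
    cost on the right is also integrable as soon as E[V] is finite.  This is (2). *)

Import Order.TTheory GRing.Theory Num.Theory.
Import numFieldNormedType.Exports.

Set Implicit Arguments.
Unset Strict Implicit.
Unset Printing Implicit Defensive.

Local Open Scope classical_set_scope.
Local Open Scope ring_scope.

(** * Hitting times of birth-death chains *)

(** First-passage probabilities of the chain that steps up from j with
    probability p j and down otherwise: the chance that, from k, it is at 0 for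
    the first time at time n. *)
Fixpoint hit (R : realType) (p : nat -> R) (n k : nat) : R :=
  match n, k with
  | 0, _ => (k == 0)%:R
  | _.+1, 0 => 0
  | n'.+1, k'.+1 => p k * hit p n' k.+1 + (1 - p k) * hit p n' k'
  end.

(** The chain is the walk on the network in which the edge between k and k + 1
    has conductance [conductance p k]. *)
Fixpoint conductance (R : realType) (p : nat -> R) (k : nat) : R :=
  if k is k'.+1 then conductance p k' * (p k / (1 - p k)) else 1.

Section birth_death.
Context (R : realType) (p : nat -> R).
Hypothesis p01 : forall k, 0 < p k.+1 < 1.

Lemma hit_ge0 n k : 0 <= hit p n k.
Proof.
elim: n k => [|n IH] [|k] //=; have /andP[p0 p1] := p01 k.
by rewrite addr_ge0// mulr_ge0// ?IH// ?ltW// subr_gt0.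
Qed.

Lemma hit_lt n k : (n < k)%N -> hit p n k = 0.
Proof.
elim: n k => [|n IH] [|k] //= nk.
by rewrite (IH k)// (IH k.+2) ?mulr0 ?addr0// !ltnS ltnW// ltnW.
Qed.

Lemma conductance_gt0 k : 0 < conductance p k.
Proof.
elim: k => [|k IH] //=; have /andP[p0 p1] := p01 k.
by rewrite mulr_gt0// divr_gt0// subr_gt0.
Qed.

Lemma sum_hit0 (f : nat -> R) N : \sum_(n < N.+1) f n * hit p n 0 = f 0.
Proof. by rewrite big_ord_recl /= mulr1 big1 ?addr0// => i _; rewrite mulr0. Qed.

Lemma sum_hitS (f : nat -> R) N k : \sum_(n < N.+1) f n * hit p n k.+1 =
  p k.+1 * (\sum_(n < N) f n.+1 * hit p n k.+2)
  + (1 - p k.+1) * (\sum_(n < N) f n.+1 * hit p n k).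
Proof.
rewrite big_ord_recl /= mulr0 add0r !mulr_sumr -big_split/=.
by apply: eq_bigr => i _; rewrite /bump leq0n/=; ring.
Qed.

(** Hitting probabilities are the smallest nonnegative solution of a Dirichlet
    problem, so their partial sums stay below any supersolution. *)
Lemma sum_hit_le (H : nat -> R) : 1 <= H 0 -> (forall k, 0 <= H k) ->
  (forall k, p k.+1 * H k.+2 + (1 - p k.+1) * H k <= H k.+1) ->
  forall N k, \sum_(n < N) hit p n k <= H k.
Proof.
move=> H0 Hge0 HS; elim=> [|N IH] k; first by rewrite big_ord0.
under eq_bigr do rewrite -[hit _ _ _]mul1r.
case: k => [|k]; first by rewrite (sum_hit0 (fun=> 1)).
rewrite (sum_hitS (fun=> 1)); apply: le_trans (HS k).
have /andP[p0 p1] := p01 k.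
have step j : \sum_(n < N) 1 * hit p n j <= H j.
  by under eq_bigr do rewrite mul1r.
by rewrite lerD// ler_wpM2l ?step// ?subr_ge0 ltW.
Qed.

(** The same domination for the hitting time: every path loses one unit of time
    at its first step, so the source term is the hitting probability, here
    replaced by the harmonic function H above it. *)
Lemma sum_time_hit_le (H K : nat -> R) : 1 <= H 0 -> (forall k, 0 <= H k) ->
  (forall k, p k.+1 * H k.+2 + (1 - p k.+1) * H k = H k.+1) ->
  (forall k, 0 <= K k) ->
  (forall k, p k.+1 * K k.+2 + (1 - p k.+1) * K k + H k.+1 <= K k.+1) ->
  forall N k, \sum_(n < N) n%:R * hit p n k <= K k.
Proof.
move=> H0 Hge0 HS K0 KS; elim=> [|N IH] k; first by rewrite big_ord0.
case: k => [|k]; first by rewrite sum_hit0.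
rewrite (sum_hitS (fun n => n%:R)); apply: le_trans (KS k).
have /andP[p0 p1] := p01 k.
have step j : \sum_(n < N) n.+1%:R * hit p n j <= K j + H j.
  under eq_bigr do rewrite -natr1 mulrDl mul1r.
  rewrite big_split/=; apply: lerD => //; apply: sum_hit_le => // i.
  by rewrite HS.
rewrite -HS addrACA -!mulrDr.
by rewrite lerD// ler_wpM2l ?step// ?subr_ge0 ltW.
Qed.

(** If H k is the probability of hitting 0 from k, then by reversibility
    (C_(y-1) + C_y) (H y)^2 is the time spent at y by the paths from 1 that hit 0.
    The upper bound follows from an explicit supersolution: H k times the time
    that the chain conditioned to hit 0 takes to descend from k to 0, which is a
    sum of times tau j of descent from j + 1 to j. *)
Lemma time_cost_le (H : nat -> R) (S : R) : H 0 = 1 -> (forall k, 0 < H k) ->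
  (forall k, p k.+1 * H k.+2 + (1 - p k.+1) * H k = H k.+1) ->
  (forall n, \sum_(y < n)
    (conductance p y + conductance p y.+1) * H y.+1 ^+ 2 <= S) ->
  forall N, \sum_(n < N) n%:R * hit p n 1 <= S.
Proof.
move=> H0 Hgt0 HS HSum N.
pose C := conductance p.
have C0 k : 0 < C k := conductance_gt0 k.
(* what S leaves for the visits above level j *)
pose T j := S - \sum_(y < j) (C y + C y.+1) * H y.+1 ^+ 2.
have T0 j : 0 <= T j by rewrite subr_ge0.
have TS j : T j = T j.+1 + (C j + C j.+1) * H j.+1 ^+ 2.
  by rewrite /T big_ord_recr/=; ring.
pose tau j := T j / (C j * H j * H j.+1).
have tau0 j : 0 <= tau j by rewrite divr_ge0// ltW// !mulr_gt0.
pose K k := H k * \sum_(j < k) tau j.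
have -> : S = K 1.
  rewrite /K big_ord1 /tau /T big_ord0 subr0 /C/= H0; field.
  by rewrite gt_eqF.
apply: (@sum_time_hit_le H) => //; first by rewrite H0.
- by move=> k; rewrite ltW.
- by move=> k; apply: mulr_ge0; [exact: ltW | exact: sumr_ge0].
move=> k; have /andP[p0 p1] := p01 k.
rewrite /K 2!big_ord_recr/=.
set s := \sum_(_ < _) _.
(* first-step equation of the conditioned chain for its times of descent *)
have key : p k.+1 * H k.+2 * tau k.+1 + H k.+1 = (1 - p k.+1) * H k * tau k.
  rewrite /tau (TS k) /C /= -/(C k).
  have := Hgt0 k; have := Hgt0 k.+1; have := Hgt0 k.+2; have := C0 k.
  move: (H k) (H k.+1) (H k.+2) (C k) (T k.+1) => h0 h1 h2 c t c0 h20 h10 h00.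
  field.
  by rewrite !gt_eqF// subr_gt0.
rewrite -[X in _ <= X * _]HS.
move: (HS k) key; move: (H k) (H k.+1) (H k.+2) (tau k) (tau k.+1) => h0 h1 h2 t0 t1.
move=> hS key.
rewrite -subr_ge0.
have -> : (p k.+1 * h2 + (1 - p k.+1) * h0) * (s + t0) -
  (p k.+1 * (h2 * (s + t0 + t1)) + (1 - p k.+1) * (h0 * s) + h1) =
  (1 - p k.+1) * h0 * t0 - (p k.+1 * h2 * t1 + h1) by ring.
by rewrite key subrr.
Qed.

Lemma sum_hit_le1 N k : \sum_(n < N) hit p n k <= 1.
Proof.
apply: (@sum_hit_le (fun=> 1)) => // j.
by rewrite !mulr1 addrC subrK.
Qed.

End birth_death.

Section birth_death_recurrent.
Context (R : realType) (p : nat -> R).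
Hypothesis p01 : forall k, 0 < p k.+1 < 1.
Hypothesis conductance0 : conductance p k @[k --> \oo] --> (0 : R).

Let hit_sum k N := \sum_(n < N) hit p n k.

Let hit_sum_cvg k : cvgn (hit_sum k).
Proof.
apply: nondecreasing_is_cvgn.
  apply/nondecreasing_seqP => N; rewrite /hit_sum big_ord_recr/=.
  by rewrite lerDl hit_ge0.
by exists 1 => _ [N _ <-]; exact: sum_hit_le1.
Qed.

Let hit_sumS j N :
  hit_sum j.+1 N.+1 = p j.+1 * hit_sum j.+2 N + (1 - p j.+1) * hit_sum j N.
Proof.
have E i M : \sum_(n < M) 1 * hit p n i = hit_sum i M.
  by apply: eq_bigr => n _; rewrite mul1r.
by have := sum_hitS p (fun=> 1) N j; rewrite !E.
Qed.

(** A harmonic function has increments proportional to the resistances, the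
    inverses of the conductances; these are unbounded, so a bounded harmonic
    function is constant. *)
Lemma hit_prob1 k : hit_sum k @ \oo --> (1 : R).
Proof.
pose h k := limn (hit_sum k).
have hc j : hit_sum j @ \oo --> h j by exact: hit_sum_cvg.
have h0 : h 0 = 1.
  apply/cvg_lim => //; rewrite -cvg_shiftS/=.
  apply: cvg_near_cst; apply: nearW => N; have := sum_hit0 p (fun=> 1) N.
  by under eq_bigr do rewrite mul1r.
have hS j : h j.+1 = p j.+1 * h j.+2 + (1 - p j.+1) * h j.
  apply/cvg_lim => //; rewrite -cvg_shiftS/=.
  under eq_fun do rewrite hit_sumS.
  exact: (cvgD (cvgMl_tmp (hc _)) (cvgMl_tmp (hc _))).
have h1 j : h j <= 1.
  by apply: limr_le; [exact: hit_sum_cvg | near=> N; exact: sum_hit_le1].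
have hge0 j : 0 <= h j.
  apply: limr_ge; first exact: hit_sum_cvg.
  by near=> N; apply: sumr_ge0 => i _; exact: hit_ge0.
have dC j : (h j - h j.+1) * conductance p j = h 0 - h 1.
  elim: j => [|j IH]; first by rewrite /= mulr1.
  rewrite -IH /=; have /andP[p0 p1] := p01 j.
  rewrite (hS j); field.
  by rewrite subr_eq0 gt_eqF.
have d_le0 : h 0 - h 1 <= 0.
  apply: (ler_cvg_to (cvg_cst (h 0 - h 1)) conductance0).
  near=> j; rewrite -(dC j) ler_piMl//; first exact/ltW/conductance_gt0.
  by rewrite lerBlDl (le_trans (h1 j))// lerDr.
have d0 : h 0 - h 1 = 0.
  by apply/eqP; rewrite eq_le d_le0 subr_ge0 h0 h1.
have h_cst j : h j = 1.
  elim: j => [//|j IH]; have /eqP := dC j.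
  by rewrite d0 mulf_eq0 (gt_eqF (conductance_gt0 p01 j)) orbF IH subr_eq0 => /eqP.
by rewrite -(h_cst k).
Unshelve. all: by end_near. Qed.

Let time_sum k N := \sum_(n < N) n%:R * hit p n k.

Let time_sumS j N : time_sum j.+1 N.+1 =
  p j.+1 * (time_sum j.+2 N + hit_sum j.+2 N)
  + (1 - p j.+1) * (time_sum j N + hit_sum j N).
Proof.
rewrite /time_sum (sum_hitS p (fun n => n%:R)).
have step i : \sum_(n < N) n.+1%:R * hit p n i = time_sum i N + hit_sum i N.
  by rewrite -big_split/=; apply: eq_bigr => n _; rewrite -natr1 mulrDl mul1r.
by rewrite !step.
Qed.

Let time_sum_ge0 j N : 0 <= time_sum j N.
Proof. by apply: sumr_ge0 => i _; rewrite mulr_ge0// hit_ge0. Qed.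

(** As 0 is hit almost surely, the expected hitting times g satisfy
    g k = 1 + (mean of g after one step).  The increments of g then obey a
    first-order recursion, and unrolling it from 0 produces the conductances
    and a remainder that has the sign of an increment. *)
Lemma time_cost_ge (G : R) : (forall N, \sum_(n < N) n%:R * hit p n 1 <= G) ->
  forall n, \sum_(i < n) conductance p i <= G.
Proof.
move=> G1.
(* finiteness spreads from level 1: level j + 2 is one step away from j + 1 *)
have bnd j : exists B, forall N, time_sum j N <= B.
  suff: (exists B, forall N, time_sum j N <= B) /\
        (exists B, forall N, time_sum j.+1 N <= B) by case.
  elim: j => [|j [_ [B IH]]].
    split; [exists 0 | by exists G].
    move=> [|N]; first by rewrite /time_sum big_ord0.
    by rewrite /time_sum sum_hit0.
  split; first by exists B.
  have /andP[p0 p1] := p01 j.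
  exists (B / p j.+1) => N; rewrite ler_pdivlMr// mulrC.
  apply: le_trans (IH N.+1); rewrite time_sumS mulrDr -addrA lerDl.
  have hs i : 0 <= hit_sum i N by apply: sumr_ge0 => ? _; exact: hit_ge0.
  have q0 : 0 <= 1 - p j.+1 by rewrite subr_ge0 ltW.
  by apply: addr_ge0; apply: mulr_ge0 => //; [exact: ltW | exact: addr_ge0].
pose g j := limn (time_sum j).
have gc j : time_sum j @ \oo --> g j.
  apply: nondecreasing_is_cvgn.
    apply/nondecreasing_seqP => N; rewrite /time_sum big_ord_recr/=.
    by rewrite lerDl mulr_ge0// hit_ge0.
  by have [B HB] := bnd j; exists B => _ [N _ <-].
have g0 : g 0 = 0.
  apply/cvg_lim => //; rewrite -cvg_shiftS/=.
  by apply: cvg_near_cst; apply: nearW => N; rewrite /time_sum sum_hit0.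
have gS j : g j.+1 = p j.+1 * g j.+2 + (1 - p j.+1) * g j + 1.
  rewrite [RHS](_ : _ = p j.+1 * (g j.+2 + 1) + (1 - p j.+1) * (g j + 1)).
    apply/cvg_lim => //; rewrite -cvg_shiftS/=.
    under eq_fun do rewrite time_sumS.
    have gh i : (fun N => time_sum i N + hit_sum i N) @ \oo --> g i + 1.
      by apply: cvgD; [exact: gc | exact: hit_prob1].
    exact: (cvgD (cvgMl_tmp (gh _)) (cvgMl_tmp (gh _))).
  by ring.
have g_ge j : j%:R <= g j.
  have jc : (fun N => j%:R * hit_sum j N) @ \oo --> (j%:R : R).
    by rewrite -[X in _ --> X]mulr1; apply: cvgMl_tmp; exact: hit_prob1.
  apply: (ler_cvg_to jc (gc j)); near=> N.
  rewrite mulr_sumr ler_sum// => n _; have [nj|jn] := ltnP n j.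
    by rewrite hit_lt// !mulr0.
  by rewrite ler_wpM2r ?hit_ge0// ler_nat.
pose a j := p j.+1 / (1 - p j.+1).
have a0 j : 0 < a j.
  by have /andP[p0 p1] := p01 j; rewrite divr_gt0// subr_gt0.
pose d j := g j.+1 - g j.
have dS j : d j = a j * d j.+1 + (1 + a j).
  have /andP[p0 p1] := p01 j.
  rewrite /d /a (gS j); field.
  by rewrite subr_eq0 gt_eqF.
(* negative increments would stay negative, but g j >= j is unbounded *)
have d_ge0 j : 0 <= d j.
  rewrite leNgt; apply/negP => dj.
  have neg m : d (j + m)%N < 0.
    elim: m => [|m]; first by rewrite addn0.
    rewrite addnS dS; have := a0 (j + m)%N; nra.
  have gle m : g (j + m)%N <= g j.
    elim: m => [|m IH]; first by rewrite addn0.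
    by rewrite addnS (le_trans _ IH)// -subr_le0 ltW// neg.
  have [m Hm] : exists m, g j < m%:R.
    by exists (Num.bound (g j)); apply: le_lt_trans (archi_boundP _);
      rewrite ?ler_norm// (le_trans _ (g_ge j)).
  have := le_trans (g_ge (j + m)%N) (gle m).
  rewrite natrD => H; have : (0 : R) <= j%:R by []; lra.
have d0_ge m : \sum_(i < m) conductance p i + conductance p m * d m <= d 0.
  elim: m => [|m IH]; first by rewrite big_ord0 add0r mul1r.
  apply: le_trans IH; rewrite big_ord_recr/= -addrA lerD2l.
  rewrite (dS m) -/(a m); have := conductance_gt0 p01 m; have := a0 m.
  by move: (conductance p m) (a m) (d m.+1) => c b e; nra.
move=> n; apply: (@le_trans _ _ (g 1)).
  have -> : g 1 = d 0 by rewrite /d g0 subr0.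
  apply: le_trans (d0_ge n).
  by rewrite lerDl mulr_ge0// ltW// conductance_gt0.
by apply: limr_le; [exact: gc | near=> N; exact: G1].
Unshelve. all: by end_near. Qed.

End birth_death_recurrent.

(** * First passages of the walk *)

Lemma measurable_coordinate (n : nat) (A : set int) :
  measurable [set X : trajectory | A (X n)].
Proof.
apply: sub_sigma_algebra; exists n => //; exists A => //.
by rewrite setTI.
Qed.

Definition path_event (m : nat) (x : nat -> int) : set trajectory :=
  [set X | forall i, (i <= m)%N -> X i = x i].

Definition passage_event (m n : nat) : set trajectory :=
  [set X | X (m + n)%N = 0 /\ forall i, (m <= i < m + n)%N -> X i <> 0].

Definition first_return (n : nat) : set trajectory :=
  [set X | X n = X 0%N /\ forall i, (0 < i < n)%N -> X i <> X 0%N].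

Definition extend (x : nat -> int) (m : nat) (y : int) : nat -> int :=
  fun i => if (i <= m)%N then x i else y.

Lemma extend_le x m y i : (i <= m)%N -> extend x m y i = x i.
Proof. by rewrite /extend => ->. Qed.

Lemma extendS x m y : extend x m y m.+1 = y.
Proof. by rewrite /extend ltnn. Qed.

Fixpoint first_passage (R : realType) (w : environment R) n (x : int) : R :=
  if n is n'.+1 then
    if x == 0 then 0
    else omega w x * first_passage w n' (x + 1)
         + (1 - omega w x) * first_passage w n' (x - 1)
  else (x == 0)%:R.

Lemma measurable_path_event m x : measurable (path_event m x).
Proof.
rewrite (_ : path_event m x =
    \bigcap_(i in [set i | (i <= m)%N]) [set X | X i = x i]).
  apply: bigcap_measurableType => // i _.
  exact: (measurable_coordinate i [set y | y = x i]).
by apply/seteqP; split.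
Qed.

Lemma measurable_passage_event m n : measurable (passage_event m n).
Proof.
rewrite (_ : passage_event m n = [set X | X (m + n)%N = 0] `&`
    \bigcap_(i in [set i | (m <= i < m + n)%N]) [set X | X i <> 0]).
  apply: measurableI; first exact: (measurable_coordinate _ [set 0]).
  apply: bigcap_measurableType => // i _.
  exact: (measurable_coordinate i [set y | y <> 0]).
by apply/seteqP; split.
Qed.

Lemma measurable_return_at n : measurable [set X : trajectory | X n = X 0%N].
Proof.
rewrite (_ : [set _ | _] =
    \bigcup_y ([set X : trajectory | X n = y] `&` [set X | X 0%N = y])).
  apply: countable_bigcupT_measurable; first exact: countableP.
  move=> y; apply: measurableI.
    exact: (measurable_coordinate _ [set y]).
  exact: (measurable_coordinate _ [set y]).
by apply/seteqP; split => [X /= E|X [y _ [/= -> ->]]//]; exists (X n).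
Qed.

Lemma measurable_first_return n : measurable (first_return n).
Proof.
rewrite (_ : first_return n = [set X | X n = X 0%N] `&`
    \bigcap_(i in [set i | (0 < i < n)%N]) ~` [set X | X i = X 0%N]).
  apply: measurableI; first exact: measurable_return_at.
  apply: bigcap_measurableType => // i _.
  by apply: measurableC; exact: measurable_return_at.
by apply/seteqP; split.
Qed.

Section walk_law.
Context (R : realType) (w : environment R)
  (mu : {measure set trajectory -> \bar R}).
Hypothesis mu_walk : is_walk_law w mu.
Hypothesis mu1 : mu setT = 1%E.
Local Open Scope ereal_scope.

Lemma path_event_extend m x y : mu (path_event m.+1 (extend x m y)) =
  mu (path_event m x) * (jump w (x m) y)%:E.
Proof.
have [_ /(_ m (extend x m y)) E] := mu_walk.
rewrite /path_event E extend_le// extendS; congr (mu _ * _).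
by apply/seteqP; split => X /= H i im; rewrite (H i im) extend_le.
Qed.

(** The next position is almost surely one of the two neighbours: the other
    positions are countably many, each with probability zero. *)
Lemma one_step m x F : measurable F ->
  mu (path_event m x `&` F) =
  mu (path_event m.+1 (extend x m (x m + 1)%R) `&` F) +
  mu (path_event m.+1 (extend x m (x m - 1)%R) `&` F).
Proof.
move=> mF.
pose E y := path_event m.+1 (extend x m y).
have EE y X : E y X <-> path_event m x X /\ X m.+1 = y.
  rewrite /E /path_event/=; split=> [H|[H Hy] i].
    split=> [i im|]; first by rewrite H ?(leqW im)// extend_le.
    by rewrite H// extendS.
  rewrite leq_eqVlt => /predU1P[->|]; first by rewrite extendS.
  by rewrite ltnS => im; rewrite extend_le// H.
pose N := path_event m x `&` [set X | X m.+1 <> (x m + 1)%R /\ X m.+1 <> (x m - 1)%R].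
have N0 : mu.-negligible N.
  pose G k := if @unpickle int k is Some y then
    if (y == x m + 1)%R || (y == x m - 1)%R then set0 else E y else set0.
  apply: (@negligibleS _ _ _ mu (\bigcup_k G k)).
    move=> X [HX [/= /eqP/negPf X1 /eqP/negPf X2]].
    by exists (pickle (X m.+1)) => //; rewrite /G pickleK X1 X2/=; apply/EE.
  apply: negligible_bigcup => k; rewrite /G; case: unpickle => [y|]; last exact: negligible_set0.
  case: ifPn => [_|]; first exact: negligible_set0.
  rewrite negb_or => /andP[/negPf y1 /negPf y2].
  exists (E y); split => //; first exact: measurable_path_event.
  by rewrite path_event_extend /jump y1 y2 mule0.
have mE y : measurable (E y `&` F).
  by apply: measurableI => //; exact: measurable_path_event.
have -> : path_event m x `&` F = (E (x m + 1)%R `&` F) `|` (E (x m - 1)%R `&` F) `|`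
    (N `&` F).
  apply/seteqP; split => X.
    move=> [HX FX].
    have [X1|/eqP X1] := eqVneq (X m.+1) (x m + 1)%R; first by left; left; split => //; apply/EE.
    have [X2|/eqP X2] := eqVneq (X m.+1) (x m - 1)%R; first by left; right; split => //; apply/EE.
    by right.
  by case=> [[] [/EE[? _] ?]|[[? _] ?]].
rewrite -(measureU mu (mE _) (mE _)); last first.
  apply/seteqP; split => X// [[/EE[_ E1] _] [/EE[_ E2] _]].
  by move: E1; rewrite E2 => /addrI.
have mN : measurable (N `&` F).
  apply: measurableI => //; apply: measurableI; first exact: measurable_path_event.
  exact: (measurable_coordinate _ [set y | y <> (x m + 1)%R /\ y <> (x m - 1)%R]).
rewrite measureU0//; first exact: (measurableU _ _ (mE _) (mE _)).
by apply: measure_negligible => //; apply: negligibleS N0 => ? [].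
Qed.

(** Iterating one_step gives the Markov property at time m, for first passages. *)
Lemma mu_passage m n x : mu (path_event m x `&` passage_event m n) =
  mu (path_event m x) * (first_passage w n (x m))%:E.
Proof.
elim: n m x => [|n IH] m x /=.
  have [x0|x0] := eqVneq (x m) 0%R.
    rewrite mule1; congr (mu _); apply/seteqP; split => [X []//|X HX].
    split => //; split => [|i]; first by rewrite addn0 HX.
    by rewrite addn0 => Hi; exfalso; lia.
  rewrite mule0 (_ : _ `&` _ = set0) ?measure0//.
  apply/seteqP; split => // X [HX [+ _]].
  by rewrite addn0 HX// => /eqP; rewrite (negPf x0).
have [x0|x0] := eqVneq (x m) 0%R.
  rewrite mule0 (_ : _ `&` _ = set0) ?measure0//.
  apply/seteqP; split => // X [HX [_ /(_ m)]].
  rewrite leqnn addnS ltnS leq_addr => /(_ isT); by rewrite HX.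
have -> : path_event m x `&` passage_event m n.+1 =
    path_event m x `&` passage_event m.+1 n.
  apply/seteqP; split => X [HX [X0 Xi]]; split => //; split.
  - by rewrite addSnnS.
  - by move=> i Hi; apply: Xi; lia.
  - by rewrite -addSnnS.
  - move=> i Hi; have [->|im] := eqVneq i m; last by apply: Xi; lia.
    by rewrite HX//; exact/eqP.
rewrite one_step; last exact: measurable_passage_event.
rewrite !IH !path_event_extend !extendS.
have -> : jump w (x m) (x m + 1) = omega w (x m) by rewrite /jump eqxx.
have -> : jump w (x m) (x m - 1) = (1 - omega w (x m))%R.
  by rewrite /jump (inj_eq (addrI _)) eqxx.
rewrite -!muleA -!EFinM -muleDr//.
rewrite ge0_fin_numE// (le_lt_trans _ (ltry 1))// -mu1 le_measure// ?inE//.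
exact: measurable_path_event.
Qed.

(** After its first step, a path from 0 that returns makes a first passage. *)
Lemma mu_first_return n : mu (first_return n.+1) =
  (omega w 0 * first_passage w n 1 + (1 - omega w 0) * first_passage w n (-1))%:E.
Proof.
have [mu0 _] := mu_walk.
pose o : nat -> int := fun=> 0%R.
have P0 : path_event 0 o = [set X | X 0%N = 0%R].
  apply/seteqP; split => X /=; first exact.
  by move=> X0 i; rewrite leqn0 => /eqP ->.
have mP0 : measurable (path_event 0 o) by exact: measurable_path_event.
have nP0 : mu (~` path_event 0 o) = 0.
  have mT : mu setT < +oo by rewrite mu1 ltry.
  rewrite -setTD (measureD measurableT mP0 mT) setTI P0.
  transitivity (1 - 1 : \bar R); last by rewrite subee.
  by congr (_ - _).
have -> : mu (first_return n.+1) = mu (path_event 0 o `&` first_return n.+1).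
  have mF := measurable_first_return n.+1.
  have mD : measurable (first_return n.+1 `\` path_event 0 o) by exact: measurableD.
  have nD : mu (first_return n.+1 `\` path_event 0 o) = 0.
    have sD : first_return n.+1 `\` path_event 0 o `<=` ~` path_event 0 o by move=> X [_].
    exact: (subset_measure0 mD (measurableC mP0) sD nP0).
  rewrite -[X in mu X = _](setUIDK (first_return n.+1) (path_event 0 o)).
  by rewrite (measureU0 (measurableI _ _ mF mP0) mD nD) setIC.
have -> : path_event 0 o `&` first_return n.+1 = path_event 0 o `&` passage_event 1 n.
  rewrite P0; apply/seteqP; split => X [/= X0 [X1 Xi]]; split => //; split.
  - by rewrite add1n X1.
  - by move=> i Hi; rewrite -X0; apply: Xi; lia.
  - by rewrite X0 -X1 add1n.
  - by move=> i Hi; rewrite X0; apply: Xi; lia.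
rewrite one_step; last exact: measurable_passage_event.
rewrite !mu_passage !path_event_extend !extendS P0 mu0 !mul1e /o /jump !add0r.
by rewrite eqxx [(-1 == 1)%R]lt_eqF// eqxx -!EFinM -EFinD.
Qed.

End walk_law.

(** * The return time *)

(** The walk on either side of 0, described by its distance to 0. *)
Definition right_chain (R : realType) (w : environment R) (k : nat) : R := omega w k%:Z.
Definition left_chain (R : realType) (w : environment R) (k : nat) : R := 1 - omega w (- k%:Z).

Lemma first_passage_right (R : realType) (w : environment R) n k :
  first_passage w n k%:Z = hit (right_chain w) n k.
Proof.
elim: n k => [|n IH] [|k] //=.
by congr (_ * _ + _ * _); rewrite -IH; congr first_passage; lia.
Qed.

Lemma first_passage_left (R : realType) (w : environment R) n k :
  first_passage w n (- k%:Z) = hit (left_chain w) n k.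
Proof.
elim: n k => [|n IH] [|k] //=.
rewrite [left_chain w k.+1]/left_chain subKr addrC.
by congr (_ * _ + _ * _); rewrite -IH; congr first_passage; lia.
Qed.

Section return_time.
Context (R : realType).
Local Open Scope ereal_scope.

Lemma return_time_first n X : first_return n.+1 X -> return_time R X = n.+1%:R%:E.
Proof.
move=> [Xn Xi]; apply/eqP; rewrite eq_le; apply/andP; split.
  by apply: ereal_inf_lbound; exists n.+1.
apply: le_ereal_inf_tmp => _ [m [m1 Xm] <-]; rewrite lee_fin ler_nat leqNgt.
by apply/negP => mn; apply: (Xi m _ Xm); rewrite m1 mn.
Qed.

Lemma first_returnP X : (exists n, first_return n.+1 X) \/
  (return_time R X = +oo /\ forall n, ~ first_return n.+1 X).
Proof.
have [[n Xn]|H] := pselect (exists n, X n.+1 = X 0%N).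
  have ex : exists n, (fun n => X n.+1 == X 0%N) n by exists n; apply/eqP.
  left; case: (ex_minnP ex) => m /eqP Xm min; exists m; split => // -[//|i] im Xi.
  by move: im; rewrite /= ltnS ltnNge => /negP; apply; apply: min; apply/eqP.
right; split; last by move=> n [Xn _]; apply: H; exists n.
rewrite /return_time (_ : [set _ | _ in _] = set0) ?ereal_inf0//.
apply/seteqP; split => // _ [[|n] [//= _ Xn] _]; apply: H; by exists n.
Qed.

(** At most one term of the series is nonzero; where none is, the left-hand side
    is +oo * 0 = 0. *)
Lemma return_time_series X :
  return_time R X * (\1_[set X | return_time R X < +oo]%E X)%:E =
  \sum_(n <oo) (n.+1%:R%:E * (\1_(first_return n.+1) X)%:E).
Proof.
have [[n Xn]|[-> X0]] := first_returnP X.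
  have E := return_time_first Xn.
  rewrite indicE mem_set/= ?E ?ltry// mule1.
  rewrite (@nneseriesD1 _ _ n)//.
  rewrite indicE mem_set//= mule1 eseries0 ?adde0// => k _ /= kn.
  rewrite indicE memNset ?mule0//= => Xk.
  by have := return_time_first Xk; rewrite E => -[] /eqP;
    rewrite eqr_nat eqSS eq_sym (negPf kn).
rewrite indicE memNset/= ?X0 ?ltxx ?mule0; last first.
  by have [[k Xk]|[->]] := first_returnP X; [case: (X0 _ Xk)|rewrite ltxx].
by rewrite eseries0// => k _ _; rewrite indicE memNset ?mule0.
Qed.

Lemma integral_return_time (mu : {measure set trajectory -> \bar R}) :
  \int[mu]_X (return_time R X * (\1_[set X | return_time R X < +oo]%E X)%:E) =
  \sum_(n <oo) (n.+1%:R%:E * mu (first_return n.+1)).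
Proof.
under eq_integral do rewrite return_time_series.
rewrite integral_nneseries//.
- apply: eq_eseriesr => n _; rewrite ge0_integralZl//.
  + by rewrite integral_indic ?setIT//; exact: measurable_first_return.
  + by apply/measurable_EFinP; apply: measurable_indic; exact: measurable_first_return.
- move=> n; apply: emeasurable_funM => //; apply/measurable_EFinP.
  by apply: measurable_indic; exact: measurable_first_return.
Qed.

Lemma measurable_returns : measurable [set X | return_time R X < +oo].
Proof.
rewrite (_ : [set _ | _] = \bigcup_n first_return n.+1).
  by apply: bigcupT_measurable => n; exact: measurable_first_return.
apply/seteqP; split => X /=.
  by have [[n Xn] _|[-> _]] := first_returnP X; [exists n|rewrite ltxx].
by move=> [n _ /return_time_first ->]; rewrite ltry.
Qed.

(** The event has probability in ]0, 1], so dividing by it preserves finiteness. *)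
Lemma cond_expectation_return_time (mu : {measure set trajectory -> \bar R}) :
  mu setT = 1 -> 0 < mu [set X | return_time R X < +oo] ->
  cond_expectation mu (return_time R) [set X | return_time R X < +oo] < +oo <->
  \sum_(n <oo) (n.+1%:R%:E * mu (first_return n.+1)) < +oo.
Proof.
move=> mu1 mu0; rewrite /cond_expectation integral_return_time.
set A := [set X | _] in mu0 *.
have : mu A <= 1.
  by rewrite -mu1 le_measure// ?inE//; exact: measurable_returns.
have s0 : 0 <= \sum_(n <oo) (n.+1%:R%:E * mu (first_return n.+1)).
  by apply: nneseries_ge0 => n _ _; rewrite mule_ge0.
move: (mu A) mu0 => [a||]// a0 _.
split.
  move: (\sum_(n <oo) _) s0 => [s||]// _; first by rewrite ltry.
  by rewrite inver gt_eqF// gt0_mulye// lte_fin invr_gt0.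
rewrite inver gt_eqF// => ?; rewrite muleC; apply: lte_mul_pinfty => //.
by rewrite lee_fin invr_ge0 ltW.
Qed.

End return_time.

(** * Symmetries and independence of an i.i.d. environment *)

Section environment_space.
Context (R : realType).
Implicit Types (w : environment R).

Lemma measurable_omega x : measurable_fun setT (fun w => omega w x).
Proof.
move=> _ B mB; rewrite setTI; apply: sub_sigma_algebra; exists x => //.
by exists B => //; rewrite setTI.
Qed.

Lemma measurable_to_environment d (T : measurableType d) (f : T -> environment R) :
  (forall x, measurable_fun setT (fun t => omega (f t) x)) -> measurable_fun setT f.
Proof.
move=> mf; apply: (@measurability _ _ _ _ setT f (@env_cylinders R)) => //.
move=> _ [_ [x _ [B mB <-]] <-]; rewrite !setTI.
by rewrite -[X in measurable X]setTI; exact: mf.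
Qed.

Definition cylinder (s : seq int) (B : int -> set R) : set (environment R) :=
  \bigcap_(i in [set` s]) ((fun w => omega w i) @^-1` B i).

Lemma measurable_cylinder s B : (forall i, measurable (B i)) -> measurable (cylinder s B).
Proof.
move=> mB; apply: fin_bigcap_measurable => [|i _]; first exact: finite_seq.
by rewrite -[X in measurable X]setTI; exact: measurable_omega.
Qed.

(** Finite cylinders are stable under intersection and generate the product
    sigma-algebra. *)
Lemma law_unique (m1 m2 : {measure set (environment R) -> \bar R}) :
  (m1 setT < +oo)%E ->
  (forall s B, uniq s -> (forall i, measurable (B i)) ->
    m1 (cylinder s B) = m2 (cylinder s B)) ->
  forall A, measurable A -> m1 A = m2 A.
Proof.
move=> m1oo m12 A mA.
pose G : set (set (environment R)) := [set C | exists s B,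
  [/\ uniq s, forall i, measurable (B i) & C = cylinder s B]].
have cyl0 : cylinder [::] (fun=> setT) = setT.
  by apply/seteqP; split => // w _ i.
apply: (@measure_unique _ _ _ G (fun=> setT)) => //.
- rewrite /measurable/=; apply/seteqP; split.
    apply: sub_sigma_algebra2 => _ [x _ [B mB <-]].
    exists [:: x], (fun=> B); split => //.
    rewrite setTI; apply/seteqP; split => w /=.
      by move=> wB i /=; rewrite inE => /eqP ->.
    by apply; rewrite /= inE.
  apply: smallest_sub; first exact: smallest_sigma_algebra.
  by move=> _ [s [B [_ mB ->]]]; exact: measurable_cylinder.
- move=> _ _ [s [B [us mB ->]]] [s' [B' [us' mB' ->]]].
  exists (undup (s ++ s')), (fun i => (if i \in s then B i else setT) `&`
    (if i \in s' then B' i else setT)); split.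
  + exact: undup_uniq.
  + by move=> i; apply: measurableI; case: ifP.
  + apply/seteqP; split => w /=.
      move=> [H H'] i _; split; case: ifP => // is_; [exact: H|exact: H'].
    move=> H; split => i /= is_.
      by have := H i; rewrite /= mem_undup mem_cat is_ => /(_ isT) [].
    by have := H i; rewrite /= mem_undup mem_cat is_ orbT => /(_ isT) [].
- by move=> _; exists [::], (fun=> setT).
- by apply/seteqP; split => // w _; exists 0%N.
- by move=> _ [s [B [us mB ->]]]; exact: m12.
Qed.

End environment_space.

Definition relabel (R : realType) (sigma : int -> int) (w : environment R) :
  environment R := fun x => w (sigma x).

Definition translate (R : realType) (k : int) (w : environment R) : environment R :=
  relabel (fun x => x + k) w.

Definition mirror (R : realType) (w : environment R) : environment R :=
  relabel (fun x => - x) w.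

(** Splicing two independent copies of an i.i.d. environment gives a third copy;
    this expresses at once the independence of the coordinates in S from those
    outside S. *)
Definition splice (R : realType) (S : pred int) (ww : environment R * environment R) :
  environment R := fun x => if S x then ww.1 x else ww.2 x.

Lemma measurable_relabel (R : realType) sigma : measurable_fun setT (@relabel R sigma).
Proof. by apply: measurable_to_environment => x; exact: measurable_omega. Qed.

Lemma measurable_splice (R : realType) S : measurable_fun setT (@splice R S).
Proof.
apply: measurable_to_environment => x; rewrite /omega /splice.
by case: (S x); exact: (measurableT_comp (measurable_omega x)).
Qed.

Section iid_environment.
Context (R : realType) (P : probability (environment R) R).
Hypothesis P_iid : iid P (fun (x : int) (w : environment R) => omega w x).
Implicit Types (w : environment R).
Local Open Scope ereal_scope.

Lemma cylinder_prob s B : uniq s -> (forall i, measurable (B i)) ->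
  P (cylinder s B) = \prod_(i <- s) P ((fun w => omega w i) @^-1` B i).
Proof. by have [_ + _] := P_iid; apply. Qed.

(** Contains both the stationarity of the environment and its invariance under
    reflection. *)
Lemma relabel_law sigma A : injective sigma -> measurable A ->
  P (relabel sigma @^-1` A) = P A.
Proof.
move=> inj mA; have mr := @measurable_relabel R sigma.
pose m : {measure set (environment R) -> \bar R} :=
  measure_function_pushforward__canonical__measure_function_Measure P mr.
apply: (@law_unique _ m P) mA => [|s B us mB].
  by rewrite /m/= /pushforward preimage_setT probability_setT ltry.
rewrite /m/= /pushforward.
(* the constraint on coordinate j, read back through the injection sigma *)
pose B' j := B (nth 0%R s (index j (map sigma s))).
have B'E i : i \in s -> B' (sigma i) = B i.
  by move=> is_; rewrite /B' index_map// nth_index.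
have -> : relabel sigma @^-1` cylinder s B = cylinder (map sigma s) B'.
  apply/seteqP; split => w /= H i /=.
    by move=> /mapP[j js ->]; rewrite B'E//; exact: H.
  by move=> is_; rewrite -(B'E i is_); apply: H; rewrite /= map_f.
rewrite !cylinder_prob ?map_inj_uniq// => [|i]; last exact: mB.
rewrite big_map big_seq [RHS]big_seq; apply: eq_bigr => i is_.
by rewrite B'E//; have [_ _] := P_iid; apply.
Qed.

Lemma splice_law S A : measurable A -> (P \x P) (splice S @^-1` A) = P A.
Proof.
move=> mA; have ms := @measurable_splice R S.
pose m : {measure set (environment R) -> \bar R} :=
  measure_function_pushforward__canonical__measure_function_Measure (P \x P) ms.
apply: (@law_unique _ m P) mA => [|s B us mB].
  rewrite /m/= /pushforward preimage_setT -setXTT product_measure1E//.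
  by rewrite [X in X * _](_ : _ = 1) ?[X in _ * X](_ : _ = 1) ?mul1e ?ltry//;
    exact: probability_setT.
rewrite /m/= /pushforward.
have -> : splice S @^-1` cylinder s B =
    cylinder [seq i <- s | S i] B `*` cylinder [seq i <- s | ~~ S i] B.
  apply/seteqP; split => -[w w'] /=.
    move=> H; split => i /=; rewrite mem_filter => /andP[Si is_];
      have := H i is_; rewrite /omega /splice/=; first by rewrite Si.
    by rewrite (negPf Si).
  move=> [H H'] i /= is_; rewrite /omega /splice/=; case: ifPn => Si.
    by apply: H; rewrite /= mem_filter Si.
  by apply: H'; rewrite /= mem_filter Si.
rewrite product_measure1E//; do ?exact: measurable_cylinder.
rewrite cylinder_prob// [RHS](bigID S)/= -big_filter -[X in _ = _ * X]big_filter.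
by congr (_ * _); apply: cylinder_prob => //; exact: filter_uniq.
Qed.

Lemma integral_relabel sigma (F : environment R -> \bar R) : injective sigma ->
  measurable_fun setT F -> (forall w, 0 <= F w) ->
  \int[P]_w F (relabel sigma w) = \int[P]_w F w.
Proof.
move=> inj mF F0; have mr := @measurable_relabel R sigma.
have := @ge0_integral_pushforward _ _ _ _ R _ mr P setT F measurableT mF (fun y _ => F0 y).
rewrite preimage_setT /= => <-.
pose m : {measure set (environment R) -> \bar R} :=
  measure_function_pushforward__canonical__measure_function_Measure P mr.
apply: (@eq_measure_integral _ _ _ _ P m) => A mA _.
exact: relabel_law.
Qed.

(** On a spliced pair F depends on the first copy and G on the second, so Fubini's
    theorem factors the integral. *)
Lemma integral_independent (S : pred int) (F G : environment R -> \bar R) :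
  measurable_fun setT F -> (forall w, 0 <= F w) ->
  measurable_fun setT G -> (forall w, 0 <= G w) ->
  (forall w w', (forall x, S x -> w x = w' x) -> F w = F w') ->
  (forall w w', (forall x, ~~ S x -> w x = w' x) -> G w = G w') ->
  \int[P]_w (F w * G w) = \int[P]_w F w * \int[P]_w G w.
Proof.
move=> mF F0 mG G0 FS GS; have ms := @measurable_splice R S.
have mFG : measurable_fun setT (fun w => F w * G w) by exact: emeasurable_funM.
have FG0 w : 0 <= F w * G w by rewrite mule_ge0.
have FE w w' : F (splice S (w, w')) = F w.
  by apply: FS => x Sx; rewrite /splice Sx.
have GE w w' : G (splice S (w, w')) = G w'.
  by apply: GS => x Sx; rewrite /splice (negPf Sx).
transitivity (\int[P \x P]_ww (F (splice S ww) * G (splice S ww))).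
  have := @ge0_integral_pushforward _ _ _ _ R _ ms (P \x P) setT _ measurableT mFG (fun y _ => FG0 y).
  rewrite preimage_setT /= => <-.
  pose m : {measure set (environment R) -> \bar R} :=
    measure_function_pushforward__canonical__measure_function_Measure (P \x P) ms.
  apply: (@eq_measure_integral _ _ _ _ m P) => A mA _.
  exact/esym/splice_law.
rewrite (fubini_tonelli1 _ (measurableT_comp mFG ms))//=.
rewrite /fubini_F -ge0_integralZr//; last exact: integral_ge0.
apply: eq_integral => w _.
rewrite -ge0_integralZl//; apply: eq_integral => w' _.
by rewrite /= FE GE.
Qed.

Lemma ae_relabel sigma (Pr : environment R -> Prop) : injective sigma ->
  {ae P, forall w, Pr w} -> {ae P, forall w, Pr (relabel sigma w)}.
Proof.
move=> inj [A [mA PA0 PrA]]; exists (relabel sigma @^-1` A); split.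
- by rewrite -[X in measurable X]setTI; exact: measurable_relabel.
- by rewrite relabel_law.
- by move=> w /= ?; exact: PrA.
Qed.

End iid_environment.

(** * Sums of i.i.d. variables with negative mean *)

(** The maximum of 0 and of the first n partial sums of phi (omega w 1),
    phi (omega w 2), and so on.  The recursion on the translated environment is
    the form that the maximal inequality uses. *)
Fixpoint running_max (R : realType) (phi : R -> R) (n : nat) (w : environment R) : R :=
  if n is n'.+1 then Num.max 0 (phi (omega w 1) + running_max phi n' (translate 1 w)) else 0.

Section iid_sums.
Context (R : realType) (phi : R -> R).
Hypothesis mphi : measurable_fun setT phi.
Implicit Types (w : environment R).
Local Notation M := (running_max phi).

Lemma omega_translate w x : omega (translate 1 w) x = omega w (x + 1).
Proof. by []. Qed.

Lemma measurable_translate1 : measurable_fun setT (@translate R 1%R).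
Proof. exact: measurable_relabel. Qed.

Lemma running_max_ge0 n w : 0 <= M n w.
Proof. by case: n => [|n] //=; rewrite le_max lexx. Qed.

Lemma running_max_nondecreasing n w : M n w <= M n.+1 w.
Proof.
elim: n w => [|n IH] w; first exact: running_max_ge0.
by rewrite [leLHS]/= [leRHS]/= le_max2// lerD2l.
Qed.

Lemma measurable_running_max n : measurable_fun setT (M n).
Proof.
elim: n => [|n IH] /=; first exact: measurable_cst.
apply: measurable_maxr => //; apply: measurable_funD.
  exact: (measurableT_comp mphi (measurable_omega 1)).
exact: (measurableT_comp IH measurable_translate1).
Qed.

Lemma partial_sum_le_running_max n w :
  \sum_(i < n) phi (omega w i.+1%:Z) <= M n w.
Proof.
elim: n w => [|n IH] w; first by rewrite big_ord0.
rewrite big_ord_recl/= le_max; apply/orP; right; rewrite lerD2l.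
apply: le_trans (IH (translate 1 w)); rewrite le_eqVlt; apply/orP; left; apply/eqP.
apply: eq_bigr => i _; rewrite omega_translate; congr (phi (omega w _)).
by rewrite /bump/=; lia.
Qed.

Lemma running_max_local n w w' : (forall x, 1 <= x -> w x = w' x) -> M n w = M n w'.
Proof.
elim: n w w' => [|n IH] w w' ww' //=.
by rewrite /omega ww'// (IH (translate 1 w) (translate 1 w'))// => x x1; apply: ww'; lia.
Qed.

Definition unbounded_sums : set (environment R) :=
  \bigcap_(C in [set: nat]) \bigcup_n [set w | C%:R < M n w].

Lemma measurable_unbounded_sums : measurable unbounded_sums.
Proof.
apply: bigcap_measurableType => // C _; apply: bigcupT_measurable => n.
rewrite -[X in measurable X]setTI.
exact: (measurable_fun_ltr (measurable_cst _) (measurable_running_max n)).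
Qed.

Lemma running_max_le m n w : (m <= n)%N -> M m w <= M n w.
Proof.
move=> mn; have /nondecreasing_seqP nd : forall k, M k w <= M k.+1 w.
  by move=> k; exact: running_max_nondecreasing.
exact: nd.
Qed.

Lemma unbounded_sums_near w : unbounded_sums w ->
  forall C : R, exists N, forall n, (N <= n)%N -> C < M n w.
Proof.
move=> wU C; have [N _ /= CN] := wU (Num.trunc C).+1 I.
exists N => n Nn; apply: lt_le_trans (running_max_le w Nn).
exact: lt_trans (truncnS_gt C) CN.
Qed.

(** Dropping the first summand shifts all later partial sums by a constant. *)
Lemma unbounded_sums_translate w : unbounded_sums (translate 1 w) <-> unbounded_sums w.
Proof.
split=> wU C _.
  have [N HN] := unbounded_sums_near wU (C%:R - phi (omega w 1)).
  exists N.+1 => //=; rewrite lt_max; apply/orP; right.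
  by rewrite -ltrBlDl HN.
have [N HN] := unbounded_sums_near wU (Num.max 0 (C%:R + phi (omega w 1))).
exists N => //=; have := HN N.+1 (leqnSn N).
rewrite /= lt_max => /orP[|].
  by rewrite gt_max ltxx.
by rewrite gt_max => /andP[_]; rewrite addrC ltrD2l.
Qed.

Lemma unbounded_sums_local w w' : (forall x, 1 <= x -> w x = w' x) ->
  unbounded_sums w -> unbounded_sums w'.
Proof.
move=> ww' wU C _; have [n _ /= Cn] := wU C I; exists n => //=.
by rewrite -(running_max_local _ ww').
Qed.

Lemma bounded_sums w : ~ unbounded_sums w ->
  exists C, forall n, \sum_(i < n) phi (omega w i.+1%:Z) <= C.
Proof.
move=> /existsNP[C /not_implyP[_ wC]]; exists C%:R => n.
apply: le_trans (partial_sum_le_running_max n w) _.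
by rewrite leNgt; apply/negP => Cn; apply: wC; exists n.
Qed.

Context (P : probability (environment R) R).
Hypothesis P_iid : iid P (fun (x : int) (w : environment R) => omega w x).
Local Open Scope ereal_scope.

Let Y w := phi (omega w 1).
Let A := unbounded_sums.
Let mA : measurable A := measurable_unbounded_sums.

Hypothesis iY : P.-integrable setT (EFin \o Y).

Let mY : measurable_fun setT Y.
Proof. exact: (measurableT_comp mphi (measurable_omega 1)). Qed.

Let succ_inj : injective (fun x : int => (x + 1)%R).
Proof. exact: addIr. Qed.

Lemma running_max_integrable n : P.-integrable setT (EFin \o M n).
Proof.
elim: n => [|n IH]; first exact: integrable0.
apply: (@le_integrable _ _ _ _ _ measurableT _
  (fun w => (`|Y w|)%:E + (M n (translate 1 w))%:E)).
- apply/measurable_EFinP; exact: (measurable_running_max n.+1).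
- move=> w _; rewrite -EFinD lee_fin/= ger0_norm ?le_max ?lexx//.
  rewrite [leRHS]ger0_norm ?addr_ge0 ?running_max_ge0//.
  rewrite ge_max addr_ge0 ?running_max_ge0//= lerD2r.
  exact: ler_norm.
- apply: integrableD => //; first exact: integrable_norm.
  have mMs : measurable_fun setT (fun w => (M n (translate 1 w))%:E).
    apply/measurable_EFinP.
    exact: (measurableT_comp (measurable_running_max n) measurable_translate1).
  apply/integrableP; split => //.
  have /integrableP[mMn] := IH.
  rewrite -(integral_relabel P_iid succ_inj)//; last exact: measurableT_comp.
Qed.

(** By stationarity and invariance of A, the difference D n between M n.+1 and the
    translate of M n has the same integral on A as M n.+1 - M n, which is
    nonnegative.  Where the maxima blow up D n is eventually equal to Y, and it
    is dominated by the absolute value of Y. *)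
Lemma maximal_ergodic_inequality : 0 <= \int[P]_(w in A) (Y w)%:E.
Proof.
pose D n w := ((M n.+1 w)%:E - (M n (translate 1 w))%:E).
have iMA n : P.-integrable A (EFin \o M n).
  by apply: integrableS (running_max_integrable n).
have MsA n : \int[P]_(w in A) (M n (translate 1 w))%:E = \int[P]_(w in A) (M n w)%:E.
  rewrite integral_mkcond [RHS]integral_mkcond.
  rewrite -[RHS](integral_relabel P_iid succ_inj).
  - apply: eq_integral => w _; rewrite /patch.
    have -> : (relabel (fun x : int => (x + 1)%R) w \in A) = (w \in A); last by [].
    by apply/idP/idP; rewrite !inE => ?; apply/unbounded_sums_translate.
  - apply/(measurable_restrictT _ _).1 => //.
    by apply: measurable_funTS; apply/measurable_EFinP; exact: measurable_running_max.
  - by move=> w; rewrite /patch; case: ifP; rewrite ?lee_fin ?running_max_ge0.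
have iMsA n : P.-integrable A (EFin \o (fun w => M n (translate 1 w))).
  apply: (@integrableS _ _ _ _ setT) => //; apply/integrableP; split.
    apply/measurable_EFinP.
    exact: (measurableT_comp (measurable_running_max n) measurable_translate1).
  have /integrableP[mMn] := running_max_integrable n.
  by rewrite -(integral_relabel P_iid succ_inj)//; last exact: measurableT_comp.
have D_ge0 n : 0 <= \int[P]_(w in A) D n w.
  rewrite /D (integralB mA (iMA n.+1) (iMsA n)) MsA sube_ge0; last by apply/orP; right; exact: integrable_fin_num.
  apply: (le_integral mA (iMA n) (iMA n.+1)).
  by move=> w _; rewrite lee_fin; exact: running_max_nondecreasing.
have cvgD w : A w -> D ^~ w @ \oo --> (Y w)%:E.
  move=> Aw; apply: cvg_near_cst.
  have /unbounded_sums_near/(_ (- Y w)%R)[N HN] : A (translate 1 w).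
    exact/unbounded_sums_translate.
  exists N => // n /= /HN Yn; rewrite /D -EFinB/=; congr EFin.
  by rewrite max_r -/(Y w) ?addrK// -lerBlDl sub0r lerNl ltW// ltrNl.
have bndD n w : `|D n w| <= `|(Y w)%:E|.
  rewrite /D -EFinB/= lee_fin -/(Y w).
  have := running_max_ge0 n (translate 1 w); move: (M n (translate 1 w)) (Y w) => m y m0.
  by rewrite ler_norml; have := ler_norm y; have := ler_norm (- y)%R; rewrite normrN maxEle; case: ifP; lra.
have mD n : measurable_fun A (D n).
  apply: emeasurable_funB; apply: measurable_funTS; apply/measurable_EFinP.
    exact: (measurable_running_max n.+1).
  exact: (measurableT_comp (measurable_running_max n) measurable_translate1).
have iYA : P.-integrable A (EFin \o Y) by apply: integrableS iY.
have lim := @dominated_cvg _ _ _ P A mA D (EFin \o Y) (abse \o (EFin \o Y))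
  mD cvgD (fun w _ => isT) (integrable_abse iYA) (fun n w _ => bndD n w).
have <- := cvg_lim (@ereal_hausdorff R) lim.
by apply: lime_ge; [apply/cvg_ex; eexists; exact: lim | exact: nearW].
Qed.

(** Being invariant, A is determined by the coordinates after the first. *)
Let integral_unbounded (f : environment R -> R) :
  measurable_fun setT f -> (forall w, 0 <= f w)%R ->
  (forall w w', w 1%R = w' 1%R -> f w = f w') ->
  \int[P]_(w in A) (f w)%:E = \int[P]_w (f w)%:E * P A.
Proof.
move=> mf f0 f1; rewrite integral_mkcond epatch_indic.
have mI : measurable_fun setT (fun w => (\1_A w)%:E : \bar R).
  by apply/measurable_EFinP; exact: measurable_indic.
have indA w w' : (A w -> A w') -> (A w' -> A w) -> (\1_A w)%:E = (\1_A w')%:E :> \bar R.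
  move=> ? ?; rewrite !indicE; have -> // : (w \in A) = (w' \in A).
  by apply/idP/idP; rewrite !inE.
rewrite (@integral_independent _ _ P_iid (pred1 1%R) (fun w => (f w)%:E))//.
- by rewrite integral_indic ?setIT.
- exact/measurable_EFinP.
- by move=> w /=; rewrite lee_fin.
- by move=> w w' H; congr EFin; apply: f1; apply: H => /=.
- move=> w w' H; have {}H x : (1 <= x)%R -> translate 1 w x = translate 1 w' x.
    by move=> x1; apply: H => /=; lia.
  by apply: indA => wA; apply: (unbounded_sums_translate _).1;
    apply: (unbounded_sums_local _ ((unbounded_sums_translate _).2 wA)) => x /H ->.
Qed.

(** By independence the maximal inequality reads E[Y] P(A) >= 0. *)
Lemma unbounded_sums_null : \int[P]_w (Y w)%:E < 0 -> P A = 0.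
Proof.
move=> Y0; have := maximal_ergodic_inequality; move: Y0.
rewrite integralE [in X in _ -> X]integralE.
have YA : P A \is a fin_num by exact: fin_num_measure.
have p0 := integrable_pos_fin_num measurableT iY.
have n0 := integrable_neg_fin_num measurableT iY.
have posE : \int[P]_(w in A) (EFin \o Y)^\+ w = \int[P]_w (EFin \o Y)^\+ w * P A.
  rewrite funerpos; apply: integral_unbounded => //.
  - exact: measurable_funrpos.
  - by move=> w w' ww'; rewrite /funrpos /Y /omega ww'.
have negE : \int[P]_(w in A) (EFin \o Y)^\- w = \int[P]_w (EFin \o Y)^\- w * P A.
  rewrite funerneg; apply: integral_unbounded => //.
  - exact: measurable_funrneg.
  - by move=> w w' ww'; rewrite /funrneg /Y /omega ww'.
have [a PAE a0] : exists2 a : R, P A = a%:E & (0 <= a)%R.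
  by exists (fine (P A)); rewrite ?fineK// fine_ge0.
rewrite posE negE !PAE; move: p0 n0.
case: (\int[P]_w _^\+ _) => // p _; case: (\int[P]_w _^\- _) => // n _.
rewrite -!EFinM -!EFinB !lee_fin lte_fin => pn H.
congr EFin; apply/eqP; rewrite eq_le a0 andbT leNgt; apply/negP => a1.
by move: H; rewrite -mulrBl leNgt pmulr_llt0// pn.
Qed.

(** This is the one-sided bound contained in the strong law of large numbers: for
    integrable phi it gives linear upper bounds with any slope above the mean. *)
Lemma ae_bounded_sums : \int[P]_w (Y w)%:E < 0 ->
  {ae P, forall w, exists C, forall n,
    (\sum_(i < n) phi (omega w i.+1%:Z) <= C)%R}.
Proof.
move=> Y0; exists A; split => //; first exact: unbounded_sums_null.
move=> w /= H; apply: contrapT => wA; apply: H; exact: bounded_sums.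
Qed.

End iid_sums.

(** * Products of odds *)

Lemma nneseries_leP (R : realType) (f : nat -> R) (B : R) : (forall n, 0 <= f n) ->
  ((\sum_(n <oo) (f n)%:E <= B%:E)%E <-> forall N, \sum_(n < N) f n <= B).
Proof.
move=> f0; split=> [fB N|fB].
  rewrite -lee_fin; apply: le_trans fB; rewrite -sumEFin -(big_mkord xpredT (fun n => (f n)%:E)).
  by apply: nneseries_lim_ge => n _ _; rewrite lee_fin.
apply: lime_le.
  by apply: is_cvg_nneseries => n _ _; rewrite lee_fin.
by apply: nearW => N; rewrite sumEFin lee_fin big_mkord.
Qed.

Lemma geometric_sum_le (R : realType) (q : R) N : 0 <= q < 1 ->
  \sum_(n < N) q ^+ n <= (1 - q)^-1.
Proof.
move=> /andP[q0 q1]; rewrite -[leRHS]mul1r ler_pdivlMr ?subr_gt0//.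
have -> : (\sum_(n < N) q ^+ n) * (1 - q) = 1 - q ^+ N.
  elim: N => [|N IH]; first by rewrite big_ord0 mul0r expr0 subrr.
  by rewrite big_ord_recr/= mulrDl IH exprS; ring.
by rewrite gerBl exprn_ge0.
Qed.

Lemma measurable_funV d (T : measurableType d) (R : realType) (f : T -> R) :
  measurable_fun setT f -> measurable_fun setT (fun x => (f x)^-1).
Proof.
move=> mf; rewrite (_ : (fun x => _) = (fun x => f x * (f x ^+ 2) `^ (-1))).
  apply: measurable_funM => //.
  by apply: (measurableT_comp (@measurable_powR R (-1))); exact: measurable_funX.
apply/funext => x; rewrite powR_inv1 ?sqr_ge0//.
have [->|fx0] := eqVneq (f x) 0; first by rewrite invr0 mul0r.
by rewrite expr2 invfM mulVKf.
Qed.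

(** The real-valued counterpart of rho. *)
Definition odds (R : realType) (w : environment R) (x : int) : R :=
  (1 - omega w x) / omega w x.

Definition odds_prod (R : realType) (n : nat) (w : environment R) : R :=
  \prod_(i < n) odds w i.+1%:Z.

Definition odds_series (R : realType) (w : environment R) : \bar R :=
  (\sum_(n <oo) (odds_prod n w)%:E)%E.

Definition odds_sum (R : realType) (w : environment R) : R := fine (odds_series w).

(** Since odds_prod n w * odds_sum (translate n w) is the tail W_n of the series,
    this is W_n^2 / (odds_prod n w * W_0^2). *)
Definition visits (R : realType) (n : nat) (w : environment R) : R :=
  odds_prod n w * odds_sum (translate n w) ^+ 2 / odds_sum w ^+ 2.

Section odds.
Context (R : realType).
Implicit Types (w : environment R).

Lemma omega_ge0 w x : 0 <= omega w x.
Proof. by rewrite /omega. Qed.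

Lemma omega_le1 w x : omega w x <= 1.
Proof. by rewrite /omega. Qed.

Lemma odds_ge0 w x : 0 <= odds w x.
Proof. by rewrite divr_ge0 ?omega_ge0// subr_ge0 omega_le1. Qed.

Lemma odds_prod_ge0 n w : 0 <= odds_prod n w.
Proof. by apply: prodr_ge0 => i _; exact: odds_ge0. Qed.

Lemma odds_series_ge0 w : (0 <= odds_series w)%E.
Proof. by apply: nneseries_ge0 => n _ _; rewrite lee_fin odds_prod_ge0. Qed.

Lemma odds_sum_ge0 w : 0 <= odds_sum w.
Proof. exact/fine_ge0/odds_series_ge0. Qed.

Lemma visits_ge0 n w : 0 <= visits n w.
Proof. by rewrite divr_ge0// ?sqr_ge0// mulr_ge0 ?sqr_ge0// odds_prod_ge0. Qed.

Lemma measurable_odds x : measurable_fun setT (fun w => odds w x).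
Proof.
apply: measurable_funM.
  by apply: measurable_funB => //; exact: measurable_omega.
by apply: measurable_funV; exact: measurable_omega.
Qed.

Lemma measurable_odds_prod n : measurable_fun setT (@odds_prod R n).
Proof. by apply: measurable_prod => i _; exact: measurable_odds. Qed.

Lemma measurable_odds_series : measurable_fun setT (@odds_series R).
Proof.
apply: ge0_emeasurable_sum => [n w _ _|n _].
  by rewrite lee_fin odds_prod_ge0.
by apply/measurable_EFinP; exact: measurable_odds_prod.
Qed.

Lemma measurable_odds_sum : measurable_fun setT (@odds_sum R).
Proof. by apply: measurableT_comp measurable_odds_series. Qed.

Lemma measurable_visits n : measurable_fun setT (@visits R n).
Proof.
apply: measurable_funM; last first.
  apply: measurable_funV.
  by apply: measurable_funX; exact: measurable_odds_sum.
apply: measurable_funM; first exact: measurable_odds_prod.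
apply: measurable_funX.
exact: (measurableT_comp measurable_odds_sum (@measurable_relabel _ _)).
Qed.

Lemma odds_translate k w x : odds (translate k w) x = odds w (x + k).
Proof. by []. Qed.

Lemma odds_prodS n w : odds_prod n.+1 w = odds w 1 * odds_prod n (translate 1 w).
Proof.
rewrite /odds_prod big_ord_recl; congr (_ * _); apply: eq_bigr => i _.
by rewrite odds_translate; congr (odds w _); rewrite /= /bump/=; lia.
Qed.

Lemma odds_prodD m n w : odds_prod (m + n) w = odds_prod m w * odds_prod n (translate m w).
Proof.
rewrite /odds_prod big_split_ord; congr (_ * _); apply: eq_bigr => i _.
by rewrite odds_translate; congr (odds w _); rewrite /=; lia.
Qed.

Lemma translate_translate j k w : translate j (translate k w) = translate (j + k) w.
Proof. by apply/funext => x; rewrite /translate /relabel -addrA. Qed.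

Lemma translate0 w : translate 0 w = w.
Proof. by apply/funext => x; rewrite /translate /relabel addr0. Qed.

Lemma odds_seriesS w :
  (odds_series w = 1 + (odds w 1)%:E * odds_series (translate 1 w))%E.
Proof.
rewrite /odds_series nneseries_recl//; last first.
  by move=> k _; rewrite lee_fin odds_prod_ge0.
rewrite {1}/odds_prod big_ord0; congr (_ + _)%E.
rewrite -nneseries_addn; last by move=> i; rewrite lee_fin odds_prod_ge0.
rewrite -nneseriesZl; last by move=> k _; rewrite lee_fin odds_prod_ge0.
by apply: eq_eseriesr => n _; rewrite addn1 odds_prodS EFinM.
Qed.

End odds.

(** * The cost of a return in a regular environment *)

Definition regular (R : realType) (w : environment R) : Prop :=
  [/\ forall x, 0 < omega w x < 1,
      forall k, (odds_series (translate k w) < +oo)%E &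
      (odds_series (mirror w) < +oo)%E].

(** Let W_n = x n / q n, so that W_(n+1) = W_n + 1 / q (n+1).  Up to the factor
    (x 0)^2 the summand is 1 / (q n * W_n^2), which for n > 0 is at most
    1 / W_(n-1) - 1 / W_n. *)
Lemma telescoping_le (R : realType) (q x r : nat -> R) :
  (forall n, 0 < r n) -> (forall n, 0 < x n) -> q 0%N = 1 ->
  (forall n, q n.+1 = q n * r n) -> (forall n, x n.+1 = 1 + r n * x n) ->
  forall N, \sum_(n < N) q n * x 0%N ^+ 2 / x n ^+ 2 <= 1 + x 0%N.
Proof.
move=> r0 x0 q0 qS xS N.
have qgt0 n : 0 < q n by elim: n => [|n IH]; rewrite ?q0// qS mulr_gt0.
have step M : \sum_(n < M.+1) q n / x n ^+ 2 <= (x 0%N ^+ 2)^-1 + (x 0%N)^-1 - q M / x M.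
  elim: M => [|M IH]; first by rewrite big_ord1 q0 !mul1r addrK.
  rewrite big_ord_recr/=; apply: (le_trans (lerD IH (lexx _))).
  rewrite -addrA lerD2l.
  have : q M / x M - q M.+1 / x M.+1 - q M.+1 / x M.+1 ^+ 2 =
      q M / (x M * x M.+1 ^+ 2).
    have := x0 M.+1; rewrite qS xS => y0; field.
    by rewrite !gt_eqF.
  have : 0 < q M / (x M * x M.+1 ^+ 2) by rewrite divr_gt0// mulr_gt0// exprn_gt0.
  by move=> /[swap] <-; lra.
have -> : \sum_(n < N) q n * x 0%N ^+ 2 / x n ^+ 2 =
    x 0%N ^+ 2 * \sum_(n < N) q n / x n ^+ 2.
  by rewrite mulr_sumr; apply: eq_bigr => n _; ring.
have x00 : 0 < x 0%N ^+ 2 by rewrite exprn_gt0.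
have -> : 1 + x 0%N = x 0%N ^+ 2 * ((x 0%N ^+ 2)^-1 + (x 0%N)^-1).
  by field; rewrite gt_eqF.
rewrite ler_pM2l//; case: N => [|N].
  by rewrite big_ord0 ltW// addr_gt0// invr_gt0.
by apply: (le_trans (step N)); rewrite gerBl ltW// divr_gt0.
Qed.

Section regular_environment.
Context (R : realType) (w : environment R).
Hypothesis w_reg : regular w.

Let w01 x : 0 < omega w x < 1. Proof. by have [] := w_reg. Qed.

Lemma odds_gt0 x : 0 < odds w x.
Proof. by have /andP[? ?] := w01 x; rewrite divr_gt0// subr_gt0. Qed.

Lemma odds_prod_gt0 n : 0 < odds_prod n w.
Proof. by apply: prodr_gt0 => i _; exact: odds_gt0. Qed.

Lemma odds_series_fin k : odds_series (translate k w) = (odds_sum (translate k w))%:E.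
Proof.
have [_ Vk _] := w_reg.
by rewrite /odds_sum fineK// ge0_fin_numE ?odds_series_ge0.
Qed.

Lemma odds_sumS k :
  odds_sum (translate k w) = 1 + odds w (k + 1) * odds_sum (translate (k + 1) w).
Proof.
have := odds_seriesS (translate k w).
rewrite translate_translate [1 + k]addrC odds_translate [1 + k]addrC.
by rewrite !odds_series_fin -EFinM -EFinD => -[].
Qed.

Lemma odds_sum_ge1 k : 1 <= odds_sum (translate k w).
Proof. by rewrite odds_sumS lerDl mulr_ge0 ?odds_ge0 ?odds_sum_ge0. Qed.

Lemma right_chain01 k : 0 < right_chain w k.+1 < 1.
Proof. exact: w01. Qed.

Lemma left_chain01 k : 0 < left_chain w k.+1 < 1.
Proof. by have /andP[? ?] := w01 (- k.+1%:Z); rewrite subr_gt0 gtrBl; apply/andP. Qed.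

Lemma conductance_right n : conductance (right_chain w) n = (odds_prod n w)^-1.
Proof.
elim: n => [|n IH]; first by rewrite /odds_prod big_ord0 invr1.
by rewrite /= IH /odds_prod big_ord_recr/= invfM /odds invf_div.
Qed.

Lemma conductance_left n : conductance (left_chain w) n = odds_prod n (mirror w).
Proof.
elim: n => [|n IH]; first by rewrite /odds_prod big_ord0.
by rewrite /= IH /odds_prod big_ord_recr/= /left_chain subKr.
Qed.

(** The harmonic function is the probability W_k / W_0 of ever reaching 0 from k. *)
Lemma right_cost_le (T : R) : (forall N, \sum_(n < N) visits n w <= T) ->
  forall N, \sum_(n < N) n%:R * hit (right_chain w) n 1 <= 2 * T.
Proof.
move=> HT.
pose v (k : nat) := odds_sum (translate k w).
have v0 k : 0 < v k by apply: lt_le_trans (odds_sum_ge1 k).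
have vS k : v k = 1 + odds w k.+1 * v k.+1.
  by rewrite /v odds_sumS (_ : k%:Z + 1 = k.+1)//; lia.
pose H (k : nat) := odds_prod k w * v k / v 0%N.
have PS k : odds_prod k.+1 w = odds_prod k w * odds w k.+1.
  by rewrite /odds_prod big_ord_recr.
have visE y : visits y w = odds_prod y w * v y ^+ 2 / v 0%N ^+ 2.
  by rewrite /v translate0.
apply: (@time_cost_le _ _ right_chain01 H).
- by rewrite /H /odds_prod big_ord0 mul1r divff// gt_eqF.
- by move=> k; rewrite divr_gt0// mulr_gt0// odds_prod_gt0.
- move=> k; rewrite /H !PS -[X in X / _]mulrA.
  have -> : odds w k.+2 * v k.+2 = v k.+1 - 1 by rewrite (vS k.+1) addrC addKr.
  rewrite (vS k); have := gt_eqF (v0 0%N); have /andP[u0 u1] := w01 k.+1.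
  rewrite /right_chain /odds; move: (v 0%N) (v k.+1) (odds_prod k w) => a b c a0.
  by field; rewrite a0 gt_eqF.
move=> n; apply: (@le_trans _ _ (\sum_(y < n) (visits y w + visits y.+1 w))).
  apply: ler_sum => y _; rewrite !conductance_right mulrDl lerD//.
    have P0 := odds_prod_gt0 y; have O0 := odds_gt0 y.+1.
    rewrite visE /H PS.
    rewrite (_ : _ * _ = odds_prod y w * (odds w y.+1 * v y.+1) ^+ 2 / v 0%N ^+ 2); last first.
      by field; rewrite !gt_eqF.
    rewrite ler_wpM2r ?invr_ge0 ?sqr_ge0// ler_pM2l//.
    apply: lerXn2r; rewrite ?nnegrE; [exact/ltW/mulr_gt0 | exact: ltW |].
    by rewrite (vS y) lerDr.
  have P0 := odds_prod_gt0 y.+1.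
  rewrite visE /H le_eqVlt; apply/orP; left; apply/eqP.
  by field; rewrite !gt_eqF.
rewrite big_split/= mulr_natl mulr2n; apply: lerD; first exact: HT.
apply: le_trans (HT n.+1); rewrite big_ord_recl -[leLHS]add0r lerD ?visits_ge0//.
Qed.

Lemma left_cost_le N :
  \sum_(n < N) n%:R * hit (left_chain w) n 1 <= 2 * odds_sum (mirror w).
Proof.
have [_ _ VR] := w_reg.
have PV n : \sum_(i < n) odds_prod i (mirror w) <= odds_sum (mirror w).
  apply: (nneseries_leP _ (fun i => odds_prod_ge0 i (mirror w))).1.
  by rewrite /odds_sum fineK// ge0_fin_numE// odds_series_ge0.
apply: (@time_cost_le _ _ left_chain01 (fun=> 1)) => // [k|n].
  by rewrite !mulr1 addrC subrK.
under eq_bigr do rewrite expr1n mulr1 !conductance_left.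
rewrite big_split/= mulr_natl mulr2n; apply: lerD; first exact: PV.
apply: le_trans (PV n.+1); rewrite big_ord_recl -[leLHS]add0r lerD ?odds_prod_ge0//.
Qed.

(** The conductances tend to 0 as the terms of a convergent series, which makes the
    chain on the left recurrent. *)
Lemma left_cost_ge (G : R) :
  (forall N, \sum_(n < N) n%:R * hit (left_chain w) n 1 <= G) ->
  (odds_series (mirror w) <= G%:E)%E.
Proof.
move=> HG; have [_ _ VR] := w_reg.
apply: (nneseries_leP _ (fun i => odds_prod_ge0 i (mirror w))).2 => n.
under eq_bigr do rewrite -conductance_left.
apply: (time_cost_ge left_chain01) HG _ => {n}.
under eq_fun do rewrite conductance_left.
apply: cvg_series_cvg_0; apply: nondecreasing_is_cvgn.
  apply/nondecreasing_seqP => n; rewrite !seriesEord/= big_ord_recr/=.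
  by rewrite lerDl odds_prod_ge0.
exists (odds_sum (mirror w)) => _ [n _ <-]; rewrite seriesEord/=.
apply: (nneseries_leP _ (fun i => odds_prod_ge0 i (mirror w))).1.
by rewrite /odds_sum fineK// ge0_fin_numE// odds_series_ge0.
Qed.

(** Translating by - n puts the current environment at distance n: its own series
    appears in the numerator of every term, and the denominators are the series
    started further and further to the left. *)
Lemma visits_translate_sum_le N :
  \sum_(n < N) visits n (translate (- n%:Z) w) <= 1 + odds_sum w.
Proof.
pose x (n : nat) := odds_sum (translate (- n%:Z) w).
pose q (n : nat) := odds_prod n (translate (- n%:Z) w).
pose r (n : nat) := odds w (- n%:Z).
have -> : odds_sum w = x 0%N by rewrite /x oppr0 translate0.
under eq_bigr do rewrite /visits translate_translate subrr -[odds_sum (translate 0 w)]/(x 0%N).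
apply: (@telescoping_le _ q x r).
- by move=> n; exact: odds_gt0.
- by move=> n; exact: (lt_le_trans ltr01 (odds_sum_ge1 _)).
- by rewrite /q /odds_prod big_ord0.
- move=> n; rewrite /q /r odds_prodS odds_translate translate_translate mulrC.
  by have -> : 1 - n.+1%:Z = - n%:Z by lia.
- move=> n; rewrite /x /r odds_sumS.
  by have -> : - n.+1%:Z + 1 = - n%:Z by lia.
Qed.

End regular_environment.

(** * Almost sure bounds *)

Section almost_sure.
Context (R : realType) (P : probability (environment R) R).
Hypothesis P_iid : iid P (fun (x : int) (w : environment R) => omega w x).
Hypothesis log_rho_integrable : P.-integrable setT (fun w => lne (rho w 0%R)).
Hypothesis E_log_rho : (-oo < \int[P]_w lne (rho w 0%R) < 0)%E.
Local Open Scope ereal_scope.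

Lemma translate_inj k : injective (fun x : int => (x + k)%R).
Proof. exact: addIr. Qed.

Lemma ae_forall_int (Pr : int -> environment R -> Prop) :
  (forall k, {ae P, forall w, Pr k w}) -> {ae P, forall w, forall k, Pr k w}.
Proof.
move=> H.
have H' : {ae P, forall w, forall n, if @unpickle int n is Some k then Pr k w else True}.
  apply: ae_foralln => n; case: unpickle => [k|]; first exact: H.
  exact: aeW.
by apply: filterS H' => w Hw k; have := Hw (pickle k); rewrite pickleK.
Qed.

Lemma rho_odds (w : environment R) x : omega w x != 0%R -> rho w x = (odds w x)%:E.
Proof. by move=> w0; rewrite /rho inver (negPf w0). Qed.

Lemma ae_omega01 : {ae P, forall w : environment R, forall x, (0 < omega w x < 1)%R}.
Proof.
apply: ae_forall_int => x.
have H : {ae P, forall w : environment R, (0 < omega w 0 < 1)%R}.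
  have := integrable_ae measurableT log_rho_integrable.
  apply: filterS => w /(_ I); rewrite !lt_neqAle omega_ge0 omega_le1 !andbT.
  apply: contraLR; rewrite negb_and !negbK => /orP[/eqP w0|/eqP w1].
    by rewrite /rho -w0 inver eqxx subr0 mul1e.
  by rewrite /rho w1 subrr mul0e le0_lneNy.
have := ae_relabel P_iid (@translate_inj x) H.
by apply: filterS => w; rewrite /omega /relabel add0r.
Qed.

Lemma integral_relabel_signed sigma (F : environment R -> \bar R) : injective sigma ->
  measurable_fun setT F -> \int[P]_w F (relabel sigma w) = \int[P]_w F w.
Proof.
move=> inj mF; rewrite integralE [RHS]integralE.
have pos := @integral_relabel _ _ P_iid sigma F^\+ inj (measurable_funepos mF) (funepos_ge0 F).
have neg := @integral_relabel _ _ P_iid sigma F^\- inj (measurable_funeneg mF) (funeneg_ge0 F).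
by rewrite -pos -neg; congr (_ - _); apply: eq_integral => w _; rewrite ?funeposE ?funenegE.
Qed.

Lemma integrable_relabel sigma (F : environment R -> \bar R) : injective sigma ->
  P.-integrable setT F -> P.-integrable setT (F \o relabel sigma).
Proof.
move=> inj /integrableP[mF iF]; apply/integrableP; split.
  by apply: (measurableT_comp mF); exact: measurable_relabel.
rewrite (integral_relabel P_iid inj (F := fun w => `|F w|))//.
exact: measurableT_comp.
Qed.

Let log_odds u : R := ln ((1 - u) / u).

Let measurable_log_odds : measurable_fun setT log_odds.
Proof.
apply: (measurableT_comp (@measurable_ln R)); apply: measurable_funM.
  exact: measurable_funB.
exact: measurable_funV.
Qed.

Let log_odds_ae : ae_eq P setT (fun w => lne (rho w 0%R))
  (fun w => (log_odds (omega w 0))%:E).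
Proof.
have := ae_omega01; apply: filterS => w /(_ 0%R) /andP[w0 w1] _.
rewrite rho_odds ?gt_eqF// lne_EFin// /odds divr_gt0// subr_gt0//.
Qed.

Let measurable_log_odds0 : measurable_fun setT
  (fun w : environment R => (log_odds (omega w 0))%:E).
Proof.
by apply/measurable_EFinP; exact: (measurableT_comp measurable_log_odds (measurable_omega 0)).
Qed.

Let integrable_log_odds : P.-integrable setT (fun w => (log_odds (omega w 0))%:E).
Proof.
have /integrableP[mL iL] := log_rho_integrable.
apply/integrableP; split => //.
rewrite (@ae_eq_integral _ _ _ P setT (fun w => `|lne (rho w 0%R)|))//.
- exact: measurableT_comp.
- exact: measurableT_comp.
- by apply: filterS log_odds_ae => w /(_ I) ->.
Qed.

Let affine_drift (a b g : R) : \int[P]_w lne (rho w 0%R) = g%:E ->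
  (a * g + b < 0)%R ->
  {ae P, forall w, exists C, forall n,
    (\sum_(i < n) (a * log_odds (omega w i.+1%:Z) + b) <= C)%R}.
Proof.
move=> Eg ab.
pose phi u := (a * log_odds u + b)%R.
have mphi : measurable_fun setT phi.
  by apply: measurable_funD => //; exact: measurable_funM.
have mb : measurable_fun setT (cst b%:E : environment R -> \bar R) by [].
have ib : P.-integrable setT (cst b%:E : environment R -> \bar R).
  exact: finite_measure_integrable_cst.
have ia : P.-integrable setT (fun w => a%:E * (log_odds (omega w 0))%:E).
  exact: integrableZl.
have i0 : P.-integrable setT (fun w => (phi (omega w 0))%:E).
  by have := integrableD measurableT ia ib; apply: eq_integrable => // w _; rewrite /phi EFinD EFinM.
have E0 : \int[P]_w (phi (omega w 0))%:E < 0.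
  rewrite (_ : \int[P]_w _ = (a * g + b)%:E) ?lte_fin//.
  transitivity (\int[P]_w (a%:E * (log_odds (omega w 0))%:E + b%:E)).
    by apply: eq_integral => w _; rewrite /phi EFinD EFinM.
  have EL : \int[P]_w (log_odds (omega w 0))%:E = g%:E.
    rewrite -Eg; apply: ae_eq_integral => //; last first.
      by apply: filterS log_odds_ae => w H /H ->.
    by have /integrableP[] := log_rho_integrable.
  have Eb : \int[P]_w (cst b%:E w) = b%:E.
    rewrite integral_cst// -[RHS]mule1; congr (_ * _); exact: probability_setT.
  by rewrite (integralD measurableT ia ib) integralZl// EL Eb -EFinM.
have omega1 (w : environment R) : omega w 1 = omega (relabel (fun x => (x + 1)%R) w) 0.
  by rewrite /omega /relabel add0r.
apply: (ae_bounded_sums mphi P_iid).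
  have := integrable_relabel (@translate_inj 1) i0.
  by apply: eq_integrable => // w _; rewrite /= omega1.
under eq_integral do rewrite omega1.
rewrite (integral_relabel_signed (@translate_inj 1) (F := fun w => (phi (omega w 0))%:E))//.
by have /integrableP[] := i0.
Qed.

Let exp_sum_log_odds (w : environment R) n : (forall x, (0 < omega w x < 1)%R) ->
  expR (\sum_(i < n) log_odds (omega w i.+1%:Z))%R = odds_prod n w.
Proof.
move=> w01; elim: n => [|n IH]; first by rewrite /odds_prod !big_ord0 expR0.
rewrite /odds_prod !big_ord_recr/= expRD IH; congr (_ * _)%R; rewrite lnK//.
by have /andP[? ?] := w01 n.+1; rewrite posrE divr_gt0// subr_gt0.
Qed.

(** With g < 0 the mean of log rho, the drift bound is applied to log rho - 7g/8
    and to - log rho + 9g/8, both of mean g/8.  The constants 7/8 and 9/8 only have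
    to be close enough to 1 for q^2 s < 1. *)
Lemma ae_exponential : exists q s : R,
  [/\ (0 < q < 1)%R, (0 < s)%R, (q ^+ 2 * s < 1)%R &
  {ae P, forall w : environment R, exists2 K : R, (0 < K)%R &
    forall n, (odds_prod n w <= K * q ^+ n)%R /\ ((odds_prod n w)^-1 <= K * s ^+ n)%R}].
Proof.
have [g Eg g0] : exists2 g : R, \int[P]_w lne (rho w 0%R) = g%:E & (g < 0)%R.
  case/andP: E_log_rho; case: (integral _ _ _) => // g _.
  by rewrite lte_fin => g0; exists g.
exists (expR (7 / 8 * g)), (expR (- (9 / 8) * g)); split.
- by rewrite expR_gt0 expR_lt1; lra.
- exact: expR_gt0.
- by rewrite -expRM_natl -expRD expR_lt1; lra.
have D1 : {ae P, forall w, exists C, forall n,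
    (\sum_(i < n) (1 * log_odds (omega w i.+1%:Z) + - (7 / 8 * g)) <= C)%R}.
  by apply: (affine_drift Eg); lra.
have D2 : {ae P, forall w, exists C, forall n,
    (\sum_(i < n) (-1 * log_odds (omega w i.+1%:Z) + - (- (9 / 8) * g)) <= C)%R}.
  by apply: (affine_drift Eg); lra.
apply: filterS3 ae_omega01 D1 D2 => w w01 [C1 H1] [C2 H2].
exists (expR C1 + expR C2)%R; first by rewrite addr_gt0 ?expR_gt0.
move=> n; rewrite -exp_sum_log_odds// -expRN -!expRM_natl; split.
  apply: (@le_trans _ _ (expR C1 * expR (n%:R * (7 / 8 * g)))%R); last first.
    by rewrite ler_wpM2r ?expR_ge0// lerDl expR_ge0.
  rewrite -expRD ler_expR; have := H1 n.
  rewrite big_split/= -mulr_sumr sumr_const card_ord -mulr_natl; lra.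
apply: (@le_trans _ _ (expR C2 * expR (n%:R * (- (9 / 8) * g)))%R); last first.
  by rewrite ler_wpM2r ?expR_ge0// lerDr expR_ge0.
rewrite -expRD ler_expR; have := H2 n.
rewrite big_split/= -mulr_sumr sumr_const card_ord -mulr_natl; lra.
Qed.

Lemma ae_odds_series : {ae P, forall w : environment R, odds_series w < +oo}.
Proof.
have [q [s [/andP[q0 q1] _ _ H]]] := ae_exponential.
apply: filterS H => w [K K0 HK].
apply: le_lt_trans (ltry (K / (1 - q))%R).
apply: (nneseries_leP _ (fun n => odds_prod_ge0 n w)).2 => N.
apply: (@le_trans _ _ (\sum_(n < N) K * q ^+ n)%R).
  by apply: ler_sum => n _; have [] := HK n.
by rewrite -mulr_sumr ler_pM2l// geometric_sum_le// ltW.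
Qed.

Lemma ae_regular : {ae P, forall w : environment R, regular w}.
Proof.
have T : {ae P, forall w : environment R, forall k, odds_series (translate k w) < +oo}.
  by apply: ae_forall_int => k; exact: (ae_relabel P_iid (@translate_inj k) ae_odds_series).
have M := ae_relabel P_iid (@oppr_inj int) ae_odds_series.
by apply: filterS3 ae_omega01 T M => w; split.
Qed.

(** In W_n^2 / (odds_prod n w * W_0^2) the tail W_n is of order q^n at most, the
    inverse of odds_prod n w of order s^n, and W_0 >= 1. *)
Lemma ae_visits : {ae P, forall w : environment R, \sum_(n <oo) (visits n w)%:E < +oo}.
Proof.
have [q [s [/andP[q0 q1] s0 qs1 H]]] := ae_exponential.
apply: filterS2 ae_regular H => w w_reg [K K0 HK].
have q1' : (0 < 1 - q)%R by rewrite subr_gt0.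
have P0 n := odds_prod_gt0 w_reg n.
have V_le (n : nat) : (odds_sum (translate n w) <= K * q ^+ n / (1 - q) / odds_prod n w)%R.
  rewrite -lee_fin -odds_series_fin//.
  apply: (nneseries_leP _ (fun i => odds_prod_ge0 i _)).2 => N.
  rewrite ler_pdivlMr// mulrC mulr_sumr.
  apply: (@le_trans _ _ (\sum_(i < N) K * q ^+ n * q ^+ i)%R).
    apply: ler_sum => i _; rewrite -odds_prodD -mulrA -exprD.
    by have [] := HK (n + i)%N.
  by rewrite -mulr_sumr ler_pM2l ?mulr_gt0 ?exprn_gt0// geometric_sum_le// ltW.
have visits_le (n : nat) : (visits n w <= K ^+ 3 / (1 - q) ^+ 2 * (q ^+ 2 * s) ^+ n)%R.
  have V0 : (1 <= odds_sum w)%R by rewrite -[w]translate0 odds_sum_ge1.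
  rewrite /visits; apply: (@le_trans _ _ (odds_prod n w * odds_sum (translate n w) ^+ 2)%R).
    rewrite ler_pdivrMr ?exprn_gt0 ?(lt_le_trans ltr01 V0)//.
    by rewrite ler_peMr ?exprn_ege1// mulr_ge0 ?sqr_ge0 ?ltW.
  apply: (@le_trans _ _ (odds_prod n w * (K * q ^+ n / (1 - q) / odds_prod n w) ^+ 2)%R).
    by rewrite ler_pM2l// lerXn2r ?nnegrE ?odds_sum_ge0// (le_trans (odds_sum_ge0 _) (V_le n)).
  have [_ Hs] := HK n.
  have -> : (odds_prod n w * (K * q ^+ n / (1 - q) / odds_prod n w) ^+ 2 =
     (K ^+ 2 / (1 - q) ^+ 2 * (q ^+ n) ^+ 2) * (odds_prod n w)^-1)%R.
    by field; rewrite !gt_eqF.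
  have -> : (K ^+ 3 / (1 - q) ^+ 2 * (q ^+ 2 * s) ^+ n =
     (K ^+ 2 / (1 - q) ^+ 2 * (q ^+ n) ^+ 2) * (K * s ^+ n))%R.
    by rewrite exprMn -exprM mulnC exprM; field; rewrite gt_eqF.
  by rewrite ler_pM2l// mulr_gt0 ?exprn_gt0// divr_gt0 ?exprn_gt0.
apply: le_lt_trans (ltry (K ^+ 3 / (1 - q) ^+ 2 * (1 - q ^+ 2 * s)^-1)%R).
apply: (nneseries_leP _ (fun n => visits_ge0 n w)).2 => N.
apply: (@le_trans _ _ (\sum_(n < N) K ^+ 3 / (1 - q) ^+ 2 * (q ^+ 2 * s) ^+ n)%R).
  exact: ler_sum.
rewrite -mulr_sumr ler_pM2l ?divr_gt0 ?exprn_gt0// geometric_sum_le//.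
by rewrite qs1 mulr_ge0 ?sqr_ge0 ?ltW.
Qed.

End almost_sure.

(** * Expectations over the environment *)

Section expectations.
Context (R : realType) (P : probability (environment R) R).
Hypothesis P_iid : iid P (fun (x : int) (w : environment R) => omega w x).
Hypothesis log_rho_integrable : P.-integrable setT (fun w => lne (rho w 0%R)).
Hypothesis E_log_rho : (-oo < \int[P]_w lne (rho w 0%R) < 0)%E.
Local Open Scope ereal_scope.
Let m := \int[P]_w rho w 0%R.

Let ae_reg := ae_regular P_iid log_rho_integrable E_log_rho.

Lemma rho_ge0 (w : environment R) x : 0 <= rho w x.
Proof.
by apply: mule_ge0; rewrite ?inve_ge0 lee_fin ?subr_ge0 ?omega_ge0 ?omega_le1.
Qed.

Lemma measurable_rho x : measurable_fun setT (fun w : environment R => rho w x).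
Proof.
have mw := measurable_omega (R := R) x.
have -> : (fun w : environment R => rho w x) = fun w => (1 - omega w x)%:E *
    (if omega w x == 0%R then +oo else ((omega w x)^-1)%:E).
  by apply/funext => w; rewrite /rho inver.
apply: emeasurable_funM; first by apply/measurable_EFinP; exact: measurable_funB.
apply: measurable_fun_ifT => //; first exact: (measurable_fun_eqr mw).
by apply/measurable_EFinP; exact: measurable_funV.
Qed.

Lemma integral_odds x : \int[P]_w (odds w x)%:E = m.
Proof.
have E0 : \int[P]_w (odds w 0)%:E = m.
  apply: ae_eq_integral => //.
  - by apply/measurable_EFinP; exact: measurable_odds.
  - exact: measurable_rho.
  - by apply: filterS ae_reg => w [w01 _ _] _; rewrite rho_odds// gt_eqF//; have /andP[] := w01 0%R.
rewrite -E0 -(integral_relabel P_iid (@translate_inj x) (F := fun w => (odds w 0)%:E)).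
- by apply: eq_integral => w _; rewrite /odds /omega /relabel add0r.
- by apply/measurable_EFinP; exact: measurable_odds.
- by move=> w; rewrite lee_fin odds_ge0.
Qed.

Lemma integral_odds_prod n : \int[P]_w (odds_prod n w)%:E = m ^+ n.
Proof.
elim: n => [|n IH].
  under eq_integral do rewrite /odds_prod big_ord0.
  by rewrite expe0 integral_cst// mul1e; exact: probability_setT.
under eq_integral do rewrite odds_prodS EFinM.
rewrite (@integral_independent _ _ P_iid (pred1 1%R) (fun w => (odds w 1)%:E)
  (fun w => (odds_prod n (translate 1 w))%:E)).
- rewrite integral_odds expeS -IH; congr (_ * _).
  apply: (integral_relabel P_iid (@translate_inj 1) (F := fun w => (odds_prod n w)%:E)).
    by apply/measurable_EFinP; exact: measurable_odds_prod.
  by move=> w; rewrite lee_fin odds_prod_ge0.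
- by apply/measurable_EFinP; exact: measurable_odds.
- by move=> w; rewrite lee_fin odds_ge0.
- apply/measurable_EFinP.
  exact: (measurableT_comp (measurable_odds_prod n) (@measurable_relabel _ _)).
- by move=> w; rewrite lee_fin odds_prod_ge0.
- by move=> w w' H; rewrite /odds /omega H//=.
- move=> w w' H; congr EFin; apply: eq_bigr => i _.
  rewrite !odds_translate /odds /omega H//=; lia.
Qed.

Lemma integral_odds_series : \int[P]_w odds_series w = \sum_(n <oo) m ^+ n.
Proof.
rewrite integral_nneseries//.
- by apply: eq_eseriesr => n _; exact: integral_odds_prod.
- by move=> n; apply/measurable_EFinP; exact: measurable_odds_prod.
- by move=> n w _; rewrite lee_fin odds_prod_ge0.
Qed.

(** The expectation of the series is a geometric series of ratio E[rho]. *)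
Lemma integral_odds_series_lty : \int[P]_w odds_series w < +oo <-> m < 1.
Proof.
have m0 : 0 <= m by apply: integral_ge0 => w _; exact: rho_ge0.
rewrite integral_odds_series; split=> [H|m1].
  rewrite ltNge; apply/negP => m1.
  have mn n : 1 <= m ^+ n.
    by elim: n => [|n IH]; rewrite ?expe0// expeS -[leLHS]mule1 lee_pmul.
  have S0 : 0 <= \sum_(n <oo) m ^+ n.
    by apply: nneseries_ge0 => n _ _; exact: le_trans (mn n).
  have := @lee_nneseries R (fun=> 1%R%:E) (fun n => m ^+ n) xpredT 0 (fun _ _ _ => lee01)
    (fun n _ => mn n).
  move: (\sum_(n <oo) m ^+ n) H S0 => [B||]// _ _ H.
  have := (nneseries_leP B (fun=> ler01)).1 H (Num.trunc B).+1.
  by rewrite sumr_const card_ord leNgt truncnS_gt.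
have [a mE a0] : exists2 a : R, m = a%:E & (0 <= a)%R.
  by move: m0 m1; case: m => // a; exists a.
move: m1; rewrite mE lte_fin => a1.
apply: le_lt_trans (ltry (1 - a)^-1%R).
under eq_eseriesr do rewrite -EFin_expe.
apply: (nneseries_leP _ (fun n => exprn_ge0 n a0)).2 => N.
by rewrite geometric_sum_le// a0.
Qed.

(** Stationarity allows the n-th term to be translated by - n, after which the sum
    is bounded pointwise; so the first moment of rho suffices, although visits n
    is quadratic in the series. *)
Lemma integral_visits_le :
  \int[P]_w (\sum_(n <oo) (visits n w)%:E) <= 1 + \int[P]_w odds_series w.
Proof.
have mv n : measurable_fun setT (fun w : environment R => (visits n w)%:E).
  by apply/measurable_EFinP; exact: measurable_visits.
have mvt n : measurable_fun setT (fun w : environment R => (visits n (translate (- n%:Z) w))%:E).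
  exact: (measurableT_comp (mv n) (@measurable_relabel _ _)).
rewrite integral_nneseries//; last by move=> n w _; rewrite lee_fin visits_ge0.
rewrite (@eq_eseriesr _ _ (fun n => \int[P]_w (visits n (translate (- n%:Z) w))%:E)); last first.
  move=> n _; apply/esym.
  by apply: (integral_relabel P_iid (@translate_inj _) (mv n)) => w; rewrite lee_fin visits_ge0.
rewrite -integral_nneseries//; last by move=> n w _; rewrite lee_fin visits_ge0.
have -> : 1 + \int[P]_w odds_series w = \int[P]_w (1 + odds_series w).
  rewrite ge0_integralD//; last 2 first.
  - by move=> w _; exact: odds_series_ge0.
  - exact: measurable_odds_series.
  by rewrite integral_cst// mul1e; congr (_ + _); exact/esym/probability_setT.
apply: ae_ge0_le_integral => //.
- by move=> w _; apply: nneseries_ge0 => n _ _; rewrite lee_fin visits_ge0.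
- by apply: ge0_emeasurable_sum => // n w _ _; rewrite lee_fin visits_ge0.
- by move=> w _; rewrite adde_ge0// odds_series_ge0.
- by apply: emeasurable_funD => //; exact: measurable_odds_series.
apply: filterS ae_reg => w w_reg _.
have := odds_series_fin w_reg 0; rewrite translate0 => ->; rewrite -EFinD.
apply: (nneseries_leP _ (fun n => visits_ge0 n _)).2 => N.
exact: visits_translate_sum_le.
Qed.

End expectations.

(** * Moments of the return time *)

Section quenched_cost.
Context (R : realType) (w : environment R)
  (mu : {measure set trajectory -> \bar R}).
Hypothesis mu_walk : is_walk_law w mu.
Hypothesis mu1 : mu setT = 1%E.
Hypothesis w_reg : regular w.

Let cost := (\sum_(n <oo) (n.+1%:R%:E * mu (first_return n.+1)))%E.
Let hr n := hit (right_chain w) n 1.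
Let hl n := hit (left_chain w) n 1.
Let a := omega w 0.

Let a01 : 0 < a < 1. Proof. by have [w01 _ _] := w_reg; exact: w01. Qed.

Let hr_ge0 n : 0 <= hr n.
Proof. exact: (hit_ge0 (right_chain01 w_reg)). Qed.

Let hl_ge0 n : 0 <= hl n.
Proof. exact: (hit_ge0 (left_chain01 w_reg)). Qed.

Let costE : cost = (\sum_(n <oo) (n.+1%:R * (a * hr n + (1 - a) * hl n))%:E)%E.
Proof.
apply: eq_eseriesr => n _; rewrite EFinM (mu_first_return mu_walk mu1).
by rewrite (first_passage_right w n 1) (first_passage_left w n 1).
Qed.

Let term_ge0 n : 0 <= n.+1%:R * (a * hr n + (1 - a) * hl n).
Proof.
have /andP[? ?] := a01.
by rewrite mulr_ge0// addr_ge0// mulr_ge0// ltW// subr_gt0.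
Qed.

Let sum_succ (f : nat -> R) N :
  \sum_(n < N) n.+1%:R * f n = \sum_(n < N) n%:R * f n + \sum_(n < N) f n.
Proof. by rewrite -big_split/=; apply: eq_bigr => n _; rewrite -natr1 mulrDl mul1r. Qed.

(** The weights omega_0 and 1 - omega_0 of the two sides are bounded by 1, and
    the first step adds at most 1 to the cost of each side. *)
Lemma cost_le (T : R) : (\sum_(n <oo) (visits n w)%:E <= T%:E)%E ->
  (cost <= (2 * T + 2 * odds_sum (mirror w) + 2)%:E)%E.
Proof.
move=> HT; rewrite costE; apply: (nneseries_leP _ term_ge0).2 => N.
have HR := right_cost_le w_reg ((nneseries_leP _ (fun n => visits_ge0 n w)).1 HT) N.
have HL := left_cost_le w_reg N.
have HR1 := sum_hit_le1 (right_chain01 w_reg) N 1.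
have HL1 := sum_hit_le1 (left_chain01 w_reg) N 1.
apply: (@le_trans _ _ (\sum_(n < N) n.+1%:R * hr n + \sum_(n < N) n.+1%:R * hl n)).
  rewrite -big_split; apply: ler_sum => n _ /=; rewrite -mulrDr ler_wpM2l//.
  have /andP[a0 a1] := a01.
  by apply: lerD; apply: ler_piMl => //; [exact: ltW | rewrite gerBl; exact: ltW].
by rewrite !sum_succ; move: HR HL HR1 HL1; rewrite /hr /hl; lra.
Qed.

(** Keeps only the returns that start with a step to the left. *)
Lemma cost_ge : ((1 - a)%:E * odds_series (mirror w) <= cost)%E.
Proof.
have : (0 <= cost)%E by rewrite costE; apply: nneseries_ge0 => n _ _; rewrite lee_fin.
case E : cost => [c||]// _; last by rewrite leey.
have /andP[a0 a1] := a01; have a1' : 0 < 1 - a by rewrite subr_gt0.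
have Hc : (cost <= c%:E)%E by rewrite E.
rewrite costE in Hc; have {}Hc := (nneseries_leP _ term_ge0).1 Hc.
have HG N : \sum_(n < N) n%:R * hl n <= c / (1 - a).
  rewrite ler_pdivlMr// mulr_suml; apply: le_trans (Hc N); apply: ler_sum => n _.
  rewrite -mulrA; apply: ler_pM; rewrite ?ler_nat//.
    by apply: mulr_ge0 => //; exact: ltW.
  by rewrite [leLHS]mulrC lerDr mulr_ge0// ltW.
have := left_cost_ge w_reg HG.
rewrite -(@lee_pmul2l _ (1 - a)%:E) ?lte_fin//.
by rewrite -EFinM mulrCA divff ?mulr1// gt_eqF.
Qed.

Lemma returns_gt0 : (0 < mu [set X | return_time R X < +oo])%E.
Proof.
apply: (@lt_le_trans _ _ (mu (first_return 2))).
  rewrite (mu_first_return mu_walk mu1) lte_fin.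
  rewrite (first_passage_right w 1 1) (first_passage_left w 1 1).
  have /andP[a0 a1] := a01.
  rewrite ltr_pwDl//; last first.
    by apply: mulr_ge0; [rewrite subr_ge0 ltW | exact: (hl_ge0 1)].
  rewrite mulr_gt0//= mulr0 add0r mulr1 subr_gt0.
  by have /andP[] := right_chain01 w_reg 0.
apply: le_measure; rewrite ?inE.
- exact: measurable_first_return.
- exact: measurable_returns.
- by move=> X /return_time_first /= ->; rewrite ltry.
Qed.

End quenched_cost.

Section return_time_moments.
Context (R : realType) (P : probability (environment R) R)
  (Q : R.-pker (environment R) ~> trajectory).
Hypothesis Q_walk : forall w : environment R, is_walk_law w (Q w).
Hypothesis P_iid : iid P (fun (x : int) (w : environment R) => omega w x).
Hypothesis log_rho_integrable : P.-integrable setT (fun w => lne (rho w 0%R)).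
Hypothesis E_log_rho : (-oo < \int[P]_w lne (rho w 0%R) < 0)%E.
Local Open Scope ereal_scope.

Let ae_reg := ae_regular P_iid log_rho_integrable E_log_rho.

Let cost (w : environment R) := \sum_(n <oo) (n.+1%:R%:E * Q w (first_return n.+1)).

Let Q1 w : Q w setT = 1. Proof. exact: prob_kernel. Qed.

Let cost_ge0 w : 0 <= cost w.
Proof. by apply: nneseries_ge0 => n _ _; rewrite mule_ge0. Qed.

Let measurable_cost_term n :
  measurable_fun setT (fun w => n.+1%:R%:E * Q w (first_return n.+1)).
Proof.
by apply: emeasurable_funM => //; apply: measurable_kernel; exact: measurable_first_return.
Qed.

Let measurable_cost : measurable_fun setT cost.
Proof.
by apply: ge0_emeasurable_sum => // n w _ _; rewrite mule_ge0.
Qed.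

Lemma quenched_lty : {ae P, forall w : environment R,
    cond_expectation (Q w) (return_time R)
      [set X | return_time R X < +oo] < +oo}.
Proof.
apply: filterS2 ae_reg (ae_visits P_iid log_rho_integrable E_log_rho) => w w_reg HT.
apply/(cond_expectation_return_time (Q1 w)).
  exact: (returns_gt0 (Q_walk w)).
have T0 : 0 <= \sum_(n <oo) (visits n w)%:E.
  by apply: nneseries_ge0 => n _ _; rewrite lee_fin visits_ge0.
have HT' : \sum_(n <oo) (visits n w)%:E <= (fine (\sum_(n <oo) (visits n w)%:E))%:E.
  by rewrite fineK// ge0_fin_numE.
exact: le_lt_trans (cost_le (Q_walk w) (Q1 w) w_reg HT') (ltry _).
Qed.

Lemma integral_cost : \int[P]_w cost w =
  \sum_(n <oo) (n.+1%:R%:E * averaged P Q (first_return n.+1)).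
Proof.
rewrite integral_nneseries//.
apply: eq_eseriesr => n _; rewrite ge0_integralZl//.
by apply: measurable_kernel; exact: measurable_first_return.
Qed.

Lemma integral_gt0_ae (f : environment R -> \bar R) : measurable_fun setT f ->
  (forall w, 0 <= f w) -> {ae P, forall w, 0 < f w} -> 0 < \int[P]_w f w.
Proof.
move=> mf f0 fgt0; rewrite lt_neqAle integral_ge0// andbT eq_sym; apply/eqP => E0.
have : \int[P]_w `|f w| = 0.
  by rewrite -[RHS]E0; apply: eq_integral => w _; rewrite gee0_abs.
move=> /(ae_eq_integral_abs P measurableT mf) E1.
have : {ae P, forall w : environment R, False}.
  by apply: filterS2 fgt0 E1 => w + /(_ I) E1; rewrite E1 ltxx.
move=> [N [mN N0 NT]].
have : P setT = 0 by apply: (subset_measure0 measurableT mN) N0 => w _; exact: NT.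
by move/eqP; rewrite probability_setT onee_eq0.
Qed.

Lemma averaged_returns_gt0 : 0 < averaged P Q [set X | return_time R X < +oo].
Proof.
apply: integral_gt0_ae => //.
  by apply: measurable_kernel; exact: measurable_returns.
by apply: filterS ae_reg => w w_reg; exact: (returns_gt0 (Q_walk w)).
Qed.

Lemma integral_mirror : \int[P]_w odds_series (mirror w) = \int[P]_w odds_series w.
Proof.
apply: (integral_relabel P_iid (@oppr_inj int)); first exact: measurable_odds_series.
exact: odds_series_ge0.
Qed.

(** Necessity rests on the independence of 1 - omega_0 and the environment on the
    negative side; sufficiency on integrating the quenched upper bound. *)
Lemma averaged_lty : cond_expectation (averaged P Q) (return_time R)
     [set X | return_time R X < +oo] < +oo <->
   \int[P]_w rho w 0%R < 1.
Proof.
rewrite (cond_expectation_return_time (probability_setT _) averaged_returns_gt0).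
rewrite -integral_cost.
rewrite -(integral_odds_series_lty P_iid log_rho_integrable E_log_rho).
have mS : measurable_fun setT (fun w : environment R => odds_series (mirror w)).
  exact: (measurableT_comp (@measurable_odds_series R) (@measurable_relabel _ _)).
split=> [costoo|Soo].
  have m1 : measurable_fun setT (fun w : environment R => (1 - omega w 0)%:E).
    by apply/measurable_EFinP; apply: measurable_funB => //; exact: measurable_omega.
  have pos1 (w : environment R) : 0 <= (1 - omega w 0)%:E by rewrite lee_fin subr_ge0 omega_le1.
  have c0 : 0 < \int[P]_w (1 - omega w 0)%:E.
    apply: integral_gt0_ae => //; apply: filterS ae_reg => w [w01 _ _].
    by rewrite lte_fin subr_gt0; have /andP[] := w01 0%R.
  have : \int[P]_w (1 - omega w 0)%:E * \int[P]_w odds_series w < +oo.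
    rewrite -integral_mirror -(@integral_independent _ _ P_iid (pred1 0%R) (fun w => (1 - omega w 0)%:E)
      (fun w => odds_series (mirror w)))//.
    - apply: le_lt_trans costoo; apply: ae_ge0_le_integral => //.
      + by move=> w _; rewrite mule_ge0// odds_series_ge0.
      + exact: emeasurable_funM.
      + by apply: filterS ae_reg => w w_reg _; exact: (cost_ge (Q_walk w)).
    - by move=> w; exact: odds_series_ge0.
    - by move=> w w' H; rewrite /omega H//=.
    - move=> w w' H; apply: eq_eseriesr => n _; congr EFin; apply: eq_bigr => i _.
      by rewrite /odds /omega /mirror /relabel H//=; lia.
  have : 0 <= \int[P]_w odds_series w.
    by apply: integral_ge0 => w _; exact: odds_series_ge0.
  by case: (\int[P]_w odds_series w) => // [s|]; rewrite ?ltry// gt0_muley.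
have mV : measurable_fun setT (fun w : environment R => \sum_(n <oo) (visits n w)%:E).
  apply: ge0_emeasurable_sum => [n w _ _|n _]; first by rewrite lee_fin visits_ge0.
  by apply/measurable_EFinP; exact: measurable_visits.
have V0 (w : environment R) : 0 <= \sum_(n <oo) (visits n w)%:E.
  by apply: nneseries_ge0 => n _ _; rewrite lee_fin visits_ge0.
pose bound (w : environment R) := 2%:E * (\sum_(n <oo) (visits n w)%:E) +
  2%:E * odds_series (mirror w) + 2%:E.
apply: (@le_lt_trans _ _ (\int[P]_w bound w)).
  apply: ae_ge0_le_integral => //.
  - by move=> w _; rewrite !adde_ge0// mule_ge0// odds_series_ge0.
  - by apply: emeasurable_funD => //; apply: emeasurable_funD; exact: emeasurable_funM.
  - apply: filterS2 ae_reg (ae_visits P_iid log_rho_integrable E_log_rho) => w w_reg HT _.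
    have [_ _ SR] := w_reg.
    have HT' : \sum_(n <oo) (visits n w)%:E = (fine (\sum_(n <oo) (visits n w)%:E))%:E.
      by rewrite fineK// ge0_fin_numE.
    have SE : odds_series (mirror w) = (odds_sum (mirror w))%:E.
      by rewrite /odds_sum fineK// ge0_fin_numE// odds_series_ge0.
    rewrite /bound SE HT' -!EFinM -!EFinD.
    by apply: (cost_le (Q_walk w) (Q1 w) w_reg); rewrite -HT'.
have mV2 : measurable_fun setT (fun w : environment R => 2%:E * \sum_(n <oo) (visits n w)%:E).
  exact: emeasurable_funM.
have mS2 : measurable_fun setT (fun w : environment R => 2%:E * odds_series (mirror w)).
  exact: emeasurable_funM.
have V20 (w : environment R) : 0 <= 2%:E * \sum_(n <oo) (visits n w)%:E.
  exact: mule_ge0.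
have S20 (w : environment R) : 0 <= 2%:E * odds_series (mirror w).
  by rewrite mule_ge0// odds_series_ge0.
rewrite (_ : \int[P]_w bound w = 2%:E * (\int[P]_w \sum_(n <oo) (visits n w)%:E) +
    2%:E * (\int[P]_w odds_series (mirror w)) + 2%:E * P setT).
  rewrite integral_mirror probability_setT mule1 !lte_add_pinfty// ?ltry//.
    apply: lte_mul_pinfty => //; apply: le_lt_trans (integral_visits_le P_iid log_rho_integrable E_log_rho) _.
    by rewrite lte_add_pinfty ?ltry.
  exact: lte_mul_pinfty.
rewrite -ge0_integralZl// -ge0_integralZl//; last by move=> w _; exact: odds_series_ge0.
rewrite -integral_cst// -ge0_integralD// -ge0_integralD//.
  by move=> w _; exact: adde_ge0.
exact: emeasurable_funD.
by move=> w _; rewrite /cst lee_fin.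
Qed.

End return_time_moments.

Unset Implicit Arguments.
Local Close Scope ring_scope.
Local Open Scope ereal_scope.

Theorem theorem1p3 (R : realType) (P : probability (environment R) R)
    (Q : R.-pker (environment R) ~> trajectory)
    (Q_walk : forall w : environment R, is_walk_law w (Q w))
    (P_iid : iid P (fun (x : int) (w : environment R) => omega w x))
    (log_rho_integrable : P.-integrable setT (fun w => lne (rho w 0%R)))
    (E_log_rho : -oo < \int[P]_w lne (rho w 0%R) < 0) :
  {ae P, forall w : environment R,
    cond_expectation (Q w) (return_time R)
      [set X | return_time R X < +oo] < +oo} /\
  (cond_expectation (averaged P Q) (return_time R)
     [set X | return_time R X < +oo] < +oo <->
   \int[P]_w rho w 0%R < 1).
Proof.
split.
- exact: quenched_lty Q_walk P_iid log_rho_integrable E_log_rho.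
- exact: averaged_lty Q_walk P_iid log_rho_integrable E_log_rho.
Qed.
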